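(* Let $r\in(0,\infty)$. Let $\nu$ be the self-similar measure associated with a family $(g_i)_{i=1}^M$ of contractive similitudes of $\mathbb{R}^q$ (contraction ratios $c_i\in(0,1)$) satisfying the open set condition and a probability vector $(t_i)_{i=1}^M$. Let $(f_i)_{i=1}^N$ be contractive similitudes of $\mathbb{R}^q$ with contraction ratios $s_i\in(0,1)$ and $(p_i)_{i=0}^N$ a probability vector with all $p_i>0$, and assume that the condensation system $((f_i)_{i=1}^N,(p_i)_{i=0}^N,\nu)$ satisfies the in-homogeneous open set condition (IOSC). Let $\mu$ be the in-homogeneous self-similar measure, i.e. the unique Borel probability measure with $\mu=p_0\nu+\sum_{i=1}^Np_i\,\mu\circ f_i^{-1}$. Let $s_r,t_r>0$ be given by $$\sum_{i=1}^M(t_ic_i^r)^{\frac{s_r}{s_r+r}}=1,\qquad \sum_{i=1}^N(p_is_i^r)^{\frac{t_r}{t_r+r}}=1,$$ and let $\xi_r:=\max\{s_r,t_r\}$. Then the quantization dimension $D_r(\mu)$ exists and equals $\xi_r$, and $\underline{Q}_r^{\xi_r}(\mu)>0$. Moreover, if $s_r>t_r$, then $\overline{Q}_r^{\xi_r}(\mu)<\infty$; if $s_r=t_r$, then $\underline{Q}_r^{\xi_r}(\mu)=\infty$.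
   Context: Here $M,N\ge 2$ and $t_i>0$ for all $i$. A family $(h_i)_{i=1}^m$ of contractive similitudes satisfies the open set condition (OSC) if there is a bounded non-empty open set $O$ with $h_i(O)\subset O$ for all $i$ and $h_i(O)\cap h_j(O)=\emptyset$ for $i\ne j$. The self-similar set of $(h_i)$ is the unique non-empty compact set $F$ with $F=\bigcup_i h_i(F)$; the self-similar measure associated with $(h_i)$ and a probability vector $(q_i)$ is the unique Borel probability measure $P$ with $P=\sum_i q_iP\circ h_i^{-1}$. $E$ denotes the self-similar set of $(f_i)_{i=1}^N$ and $C={\rm supp}(\nu)$, the self-similar set of $(g_i)_{i=1}^M$. IOSC: there is a bounded non-empty open set $U\subset\mathbb{R}^q$ such that (A1) $f_i(U)\subset U$ for all $1\le i\le N$; (A2) $f_i(U)$, $1\le i\le N$, are pairwise disjoint; (A3) $E\cap U\ne\emptyset$ and $C\subset U$; (A4) $\nu(\partial U)=0$ and $C\cap f_i({\rm cl}(U))=\emptyset$ for all $1\le i\le N$. For a Borel probability measure $P$ on $\mathbb{R}^q$: $e_{n,r}(P):=\inf_{\alpha}\big(\int d(x,\alpha)^r\,dP(x)\big)^{1/r}$, the infimum over all $\alpha\subset\mathbb{R}^q$ with $1\le{\rm card}(\alpha)\le n$. $\overline{D}_r(P):=\limsup_{n\to\infty}\frac{\log n}{-\log e_{n,r}(P)}$, $\underline{D}_r(P):=\liminf_{n\to\infty}\frac{\log n}{-\log e_{n,r}(P)}$; if these agree the common value is the quantization dimension $D_r(P)$. For $s>0$: $\overline{Q}_r^s(P):=\limsup_{n\to\infty}n^{1/s}e_{n,r}(P)$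 and $\underline{Q}_r^s(P):=\liminf_{n\to\infty}n^{1/s}e_{n,r}(P)$. *)

(* Defs.v *)
From HB Require Import structures.
From mathcomp Require Import all_boot all_order all_algebra.
From mathcomp Require Import all_classical all_reals all_analysis.

Set Implicit Arguments.
Unset Strict Implicit.
Unset Printing Implicit Defensive.
Import Order.TTheory GRing.Theory Num.Theory.
Import numFieldNormedType.Exports.

Local Open Scope classical_set_scope.
Local Open Scope ring_scope.

(* R^q is 'rV[R]_q. The library norm on 'rV[R]_q is the sup norm; it is used
   only through the topology and the bounded sets it defines, which are the
   Euclidean ones. All metric notions below use the Euclidean distance. *)
Definition l2dist (R : realType) (q : nat) (x y : 'rV[R]_q) : R :=
  Num.sqrt (\sum_(i < q) (x ord0 i - y ord0 i) ^+ 2).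

Definition l2dist_set (R : realType) (q : nat) (x : 'rV[R]_q)
    (a : set 'rV[R]_q) : R :=
  inf [set l2dist x y | y in a].

Notation borel_rV R q := (g_sigma_algebraType (@open 'rV[R]_q)).

Definition contractive_similitude (R : realType) (q : nat)
    (h : 'rV[R]_q -> 'rV[R]_q) (c : R) : Prop :=
  0 < c < 1 /\ forall x y, l2dist (h x) (h y) = c * l2dist x y.

Definition probability_vector (R : realType) (m : nat) (w : 'I_m -> R) : Prop :=
  (forall i, 0 <= w i) /\ \sum_(i < m) w i = 1.

Definition open_set_condition (R : realType) (q m : nat)
    (h : 'I_m -> 'rV[R]_q -> 'rV[R]_q) : Prop :=
  exists O : set 'rV[R]_q,
    [/\ open O, bounded_set O, O !=set0,
        (forall i, h i @` O `<=` O) &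
        (forall i j, i != j -> h i @` O `&` h j @` O = set0)].

Definition self_similar_set (R : realType) (q m : nat)
    (h : 'I_m -> 'rV[R]_q -> 'rV[R]_q) (F : set 'rV[R]_q) : Prop :=
  [/\ F !=set0, compact F & F = \bigcup_i (h i @` F)].

Definition self_similar_measure (R : realType) (q m : nat)
    (h : 'I_m -> 'rV[R]_q -> 'rV[R]_q) (w : 'I_m -> R)
    (P : probability (borel_rV R q) R) : Prop :=
  forall A : set (borel_rV R q), measurable A ->
    P A = (\sum_(i < m) (w i)%:E * P (h i @^-1` A))%E.

(* The weight of nu is p ord0; that of f i is p (lift ord0 i), i.e. p_(i+1),
   the maps f being indexed from 0. *)
Definition inhomogeneous_self_similar_measure (R : realType) (q N : nat)
    (f : 'I_N -> 'rV[R]_q -> 'rV[R]_q) (p : 'I_N.+1 -> R)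
    (nu mu : probability (borel_rV R q) R) : Prop :=
  forall A : set (borel_rV R q), measurable A ->
    mu A = ((p ord0)%:E * nu A +
            \sum_(i < N) (p (lift ord0 i))%:E * mu (f i @^-1` A))%E.

Definition msupport (R : realType) (q : nat)
    (P : probability (borel_rV R q) R) : set 'rV[R]_q :=
  [set x | forall V : set 'rV[R]_q, open V -> V x -> (0 < P V)%E].

Definition boundary (T : topologicalType) (U : set T) : set T :=
  closure U `\` interior U.

(* E is meant to be the self-similar set of f. *)
Definition inhomogeneous_OSC (R : realType) (q N : nat)
    (f : 'I_N -> 'rV[R]_q -> 'rV[R]_q) (E : set 'rV[R]_q)
    (nu : probability (borel_rV R q) R) : Prop :=
  exists U : set 'rV[R]_q,
    [/\ open U, bounded_set U & U !=set0] /\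
    [/\ (forall i, f i @` U `<=` U),
        (forall i j, i != j -> f i @` U `&` f j @` U = set0),
        (E `&` U !=set0 /\ msupport nu `<=` U) &
        (nu (boundary U) = 0%E /\
         forall i, msupport nu `&` (f i @` closure U) = set0)].

Definition quantization_error (R : realType) (q : nat) (r : R)
    (P : probability (borel_rV R q) R) (n : nat) : \bar R :=
  ereal_inf
    [set poweR (\int[P]_x (l2dist_set x a `^ r)%:E)%E r^-1
    | a in [set a : set 'rV[R]_q | a !=set0 /\ (a #<= `I_n)%card]].

(* Since fine +oo = 0, ln 0 = 0 and x / 0 = 0, the quotient is 0 when the
   error is 0 or +oo, as it is with log 0 = -oo and log +oo = +oo. *)
Definition quantization_ratio (R : realType) (q : nat) (r : R)
    (P : probability (borel_rV R q) R) (n : nat) : \bar R :=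
  (ln n%:R / - ln (fine (quantization_error r P n)))%:E.

Definition upper_quantization_dim (R : realType) (q : nat) (r : R)
    (P : probability (borel_rV R q) R) : \bar R :=
  limn_esup (quantization_ratio r P).

Definition lower_quantization_dim (R : realType) (q : nat) (r : R)
    (P : probability (borel_rV R q) R) : \bar R :=
  limn_einf (quantization_ratio r P).

Definition has_quantization_dim (R : realType) (q : nat) (r : R)
    (P : probability (borel_rV R q) R) (d : \bar R) : Prop :=
  upper_quantization_dim r P = d /\ lower_quantization_dim r P = d.

Definition upper_quantization_coef (R : realType) (q : nat) (r s : R)
    (P : probability (borel_rV R q) R) : \bar R :=
  limn_esup (fun n => ((n%:R `^ s^-1)%:E * quantization_error r P n)%E).

Definition lower_quantization_coef (R : realType) (q : nat) (r s : R)
    (P : probability (borel_rV R q) R) : \bar R :=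
  limn_einf (fun n => ((n%:R `^ s^-1)%:E * quantization_error r P n)%E).

(* Main.v *)
Require Import Defs.
From HB Require Import structures.
From mathcomp Require Import all_boot all_order all_algebra.
From mathcomp Require Import all_classical all_reals all_analysis.
From mathcomp Require Import finmap measurable_realfun ring lra.
Import Order.TTheory GRing.Theory Num.Theory.
Import numFieldNormedType.Exports.
Set Implicit Arguments.
Unset Strict Implicit.
Unset Printing Implicit Defensive.
Local Open Scope classical_set_scope.
Local Open Scope ring_scope.

(** Write [V n P] for the [n]-th quantization error of [P] to the power [r].
    For a map of mass [w] and ratio [c] let its proportion at the dimension [s]
    be [v = (w * c `^ r) `^ (s / (s + r))], so that [w * c `^ r = v `^ e] with
    [e = 1 + r / s].  The proportions of the [g i] sum to [1] at [s_r], those of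
    the [f i] at [t_r], and the claims compare [V n mu] with [n `^ (1 - e)].

    Upper bounds.  If a map of proportion [v] gets [x * v] of a budget of [x]
    points, its error [v `^ e * (x * v) `^ (1 - e)] is [v * x `^ (1 - e)], so
    the bound [x `^ (1 - e)] reproduces itself when the proportions sum to at
    most [1] ([self_similar_covered]).  For [s > t_r] the proportions of the
    [f i] leave room, and a further budget for [nu] changes only the constants
    ([inhomogeneous_covered]).

    Lower bounds.  The same division of a budget [x], read backwards, produces
    at least [x] disjoint similar copies of the measure inside itself, each of
    which would contribute an error of order [x `^ - e] if it were approximated
    by a single point ([packed_growth]).  The difficulty is that the copies
    have very different sizes, so that one of the [n] points can lie close to
    many copies.  A copy is called crowded if the points near it, seen at its
    own scale, are at least two.  Inserting the [n] points in the
    farthest-point order gives every point a scale of insertion, and every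
    crowded copy has near it a point whose scale is comparable to its size.  As
    disjoint copies of one size near one point are boundedly many, at most
    [C * n] copies are crowded ([card_crowded]).  Each of the other copies
    contributes its full share, because the measure is not a point mass
    ([uncrowded_integral]).  The open set condition enters through the
    separation of copies of a comparable size.  With [x] a large multiple of
    [n] this bounds [V n mu] below by a multiple of [n `^ (1 - e)], through
    [nu <= mu / p_0] at [s_r] and through the copies of [mu] under the [f i] at
    [t_r] ([packed_error], [self_similar_error]).

    If [s_r = t_r], both families of proportions sum to [1] at the same
    dimension.  Then the copies of [nu] on each level of the condensation
    system are as numerous as on the first one, and [k] levels together produce
    [k * x] copies of error [x `^ - e] ([interleaved_growth]); hence
    [V n mu * n `^ (e - 1)] exceeds a multiple of [k `^ e] for every [k] and all
    large [n].  The copies on different levels are disjoint since the support of [nu] has a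
    neighbourhood in the open set that avoids its images under the [f i]
    ([seed_halo]). *)

(** * The Euclidean distance *)

Section euclid.
Variables (R : realType) (q : nat).
Implicit Types x y z u v : 'rV[R]_q.

Definition dot u v : R := \sum_i u ord0 i * v ord0 i.

Lemma dotC u v : dot u v = dot v u.
Proof. by apply: eq_bigr => i _; rewrite mulrC. Qed.

Lemma dotDl u v w : dot (u + v) w = dot u w + dot v w.
Proof. by rewrite -big_split; apply: eq_bigr => i _; rewrite mxE mulrDl. Qed.

Lemma dotZl a u w : dot (a *: u) w = a * dot u w.
Proof. by rewrite mulr_sumr; apply: eq_bigr => i _; rewrite mxE mulrA. Qed.

Lemma dotNl u w : dot (- u) w = - dot u w.
Proof. by rewrite -scaleN1r dotZl mulN1r. Qed.

Lemma dot_ge0 u : 0 <= dot u u.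
Proof. by apply: sumr_ge0 => i _; rewrite -expr2 sqr_ge0. Qed.

Lemma dot_eq0 u : dot u u = 0 -> u = 0.
Proof.
move=> u0; apply/rowP => i; rewrite mxE; apply/eqP.
have /(_ i isT) : forall j, true -> u ord0 j * u ord0 j = 0.
  by apply: psumr_eq0P => // j _; rewrite -expr2 sqr_ge0.
by move/eqP; rewrite -expr2 sqrf_eq0.
Qed.

Lemma sqr_l2dist x y : l2dist x y ^+ 2 = dot (x - y) (x - y).
Proof.
rewrite sqr_sqrtr; first by apply: eq_bigr => i _; rewrite !mxE expr2.
by apply: sumr_ge0 => i _; exact: sqr_ge0.
Qed.

Lemma l2dist_ge0 x y : 0 <= l2dist x y.
Proof. exact: sqrtr_ge0. Qed.

Lemma l2distC x y : l2dist x y = l2dist y x.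
Proof. by congr Num.sqrt; apply: eq_bigr => i _; rewrite -sqrrN opprB. Qed.

Lemma l2distxx x : l2dist x x = 0.
Proof.
by rewrite /l2dist big1 ?sqrtr0// => i _; rewrite subrr expr0n.
Qed.

Lemma l2dist_eq0 x y : l2dist x y = 0 -> x = y.
Proof.
move=> xy0; apply/eqP; rewrite -subr_eq0; apply/eqP/dot_eq0.
by rewrite -sqr_l2dist xy0 expr0n.
Qed.

Lemma sqr_dot_le u v : dot u v ^+ 2 <= dot u u * dot v v.
Proof.
have := dot_ge0 (dot v v *: u - dot u v *: v).
rewrite dotDl dotNl !dotZl ![dot _ (_ - _)]dotC !(dotDl, dotNl, dotZl).
rewrite (dotC v u); have := dot_ge0 v.
have [/dot_eq0 -> _ _|vn0 v0] := eqVneq (dot v v) 0.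
  have dot0 w : dot w 0 = 0 by apply: big1 => i _; rewrite mxE mulr0.
  by rewrite !dot0 expr0n mulr0.
have {vn0 v0} v0 : 0 < dot v v by rewrite lt_neqAle eq_sym vn0.
move=> h; rewrite -subr_ge0 -(pmulr_rge0 _ v0).
by apply: le_trans h _; rewrite le_eqVlt; apply/orP; left; apply/eqP; ring.
Qed.

Lemma l2dist_triangle y x z : l2dist x z <= l2dist x y + l2dist y z.
Proof.
have a0 := l2dist_ge0 x y; have b0 := l2dist_ge0 y z.
rewrite -(@ler_pXn2r _ 2)// ?nnegrE ?l2dist_ge0 ?addr_ge0//.
have -> : l2dist x z ^+ 2 = l2dist x y ^+ 2 + l2dist y z ^+ 2 +
    2 * dot (x - y) (y - z).
  rewrite !sqr_l2dist.
  have -> : x - z = (x - y) + (y - z) by rewrite addrA subrK.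
  move: (x - y) (y - z) => u v.
  by rewrite dotDl !(dotC _ (u + v)) !dotDl (dotC v u); ring.
suff : dot (x - y) (y - z) <= l2dist x y * l2dist y z.
  by move=> h; rewrite sqrrD; lra.
rewrite (le_trans (ler_norm _))// -(@ler_pXn2r _ 2)// ?nnegrE ?mulr_ge0//.
by rewrite -normrX ger0_norm ?sqr_ge0// exprMn !sqr_l2dist sqr_dot_le.
Qed.

Lemma coord_le_l2dist x y i : `|x ord0 i - y ord0 i| <= l2dist x y.
Proof.
rewrite -(@ler_pXn2r _ 2)// ?nnegrE ?l2dist_ge0// -normrX ger0_norm ?sqr_ge0//.
rewrite sqr_sqrtr; last by apply: sumr_ge0 => j _; exact: sqr_ge0.
rewrite (bigD1 i)//= lerDl.
by apply: sumr_ge0 => j _; exact: sqr_ge0.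
Qed.

Lemma l2dist_le_sum x y : l2dist x y <= \sum_i `|x ord0 i - y ord0 i|.
Proof.
have s0 (P : pred 'I_q) : 0 <= \sum_(i | P i) `|x ord0 i - y ord0 i|.
  by apply: sumr_ge0.
rewrite -(@ler_pXn2r _ 2)// ?nnegrE ?l2dist_ge0//.
rewrite sqr_sqrtr; last by apply: sumr_ge0 => j _; exact: sqr_ge0.
rewrite expr2 mulr_suml; apply: ler_sum => i _.
rewrite -[leLHS]ger0_norm ?sqr_ge0// normrX expr2 ler_wpM2l//.
by rewrite (bigD1 i)//= lerDl.
Qed.

Lemma norm_le_l2dist x y : `|x - y| <= l2dist x y.
Proof.
rewrite [leLHS]mx_normrE; apply: bigmax_le; first exact: l2dist_ge0.
by move=> [i j] _; rewrite /= !mxE !ord1 coord_le_l2dist.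
Qed.

Lemma l2dist_le_norm x y : l2dist x y <= q%:R * `|x - y|.
Proof.
rewrite (le_trans (l2dist_le_sum x y))//.
have -> : q%:R * `|x - y| = \sum_(i < q) `|x - y|.
  by rewrite sumr_const card_ord mulr_natl.
apply: ler_sum => i _.
rewrite [leRHS]mx_normrE.
apply: le_trans (le_bigmax _ _ (ord0, i)).
by rewrite /= !mxE.
Qed.

Lemma openP_l2 (O : set 'rV[R]_q) x : open O -> O x ->
  exists2 e, 0 < e & forall y, l2dist x y < e -> O y.
Proof.
move=> oO Ox; have /nbhs_ballP[e e0 he] : nbhs x O by exact: open_nbhs_nbhs.
exists e => // y xy; apply: he; rewrite -ball_normE /ball_ /=.
exact: le_lt_trans (norm_le_l2dist _ _) xy.
Qed.

Lemma nbhs_l2ball x (e : R) : 0 < e -> nbhs x [set y | l2dist x y < e].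
Proof.
move=> e0; apply/nbhs_ballP; exists (e / q.+1%:R) => /=; first by rewrite divr_gt0.
move=> y; rewrite -ball_normE /ball_ /= ltr_pdivlMr// => h.
apply: le_lt_trans (l2dist_le_norm _ _) _; apply: le_lt_trans h.
by rewrite mulrC ler_wpM2l// ler_nat.
Qed.

Lemma open_l2ball x (e : R) : open [set y | l2dist x y < e].
Proof.
rewrite openE => y /= xy; have e0 : 0 < e - l2dist x y by rewrite subr_gt0.
apply: (@filterS _ (nbhs y) _ _ _ _ (nbhs_l2ball y e0)) => z /= yz.
by apply: le_lt_trans (l2dist_triangle y x z) _; lra.
Qed.

Lemma continuous_l2lip (phi : 'rV[R]_q -> R) (c : R) : 0 < c ->
  (forall x y, `|phi x - phi y| <= c * l2dist x y) -> continuous phi.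
Proof.
move=> c0 lip x; apply/(@cvgrPdist_lt _ _ _ (nbhs x)) => e e0.
have ec0 : 0 < c^-1 * e by rewrite mulr_gt0 ?invr_gt0.
apply: (@filterS _ (nbhs x) _ _ _ _ (nbhs_l2ball x ec0)) => y /= xy.
by apply: le_lt_trans (lip _ _) _; rewrite -ltr_pdivlMl.
Qed.

End euclid.

(** * Similitudes and packing *)

Section similitudes.
Variables (R : realType) (q : nat).
Implicit Types (x y z u v : 'rV[R]_q) (h : 'rV[R]_q -> 'rV[R]_q) (c : R).

Definition similitude h c :=
  0 < c /\ forall x y, l2dist (h x) (h y) = c * l2dist x y.

Lemma similitude_id : similitude id 1.
Proof. by split=> // x y; rewrite mul1r. Qed.

Lemma similitude_comp h1 c1 h2 c2 : similitude h1 c1 -> similitude h2 c2 ->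
  similitude (h1 \o h2) (c1 * c2).
Proof.
move=> [c10 e1] [c20 e2]; split; first exact: mulr_gt0.
by move=> x y; rewrite /= e1 e2 mulrA.
Qed.

Lemma similitude_inj h c : similitude h c -> injective h.
Proof.
move=> [c0 e] x y hxy; apply: l2dist_eq0.
have /eqP := e x y; rewrite hxy l2distxx eq_sym mulf_eq0 gt_eqF//=.
by move/eqP.
Qed.

(** After normalization a similitude preserves scalar products, by
    polarization; it is then the linear map whose matrix has the images of the
    basis vectors as rows, and that matrix is orthogonal. *)
Lemma similitude_surj h c : similitude h c -> forall y, exists x, h x = y.
Proof.
move=> [c0 hc] y; have cn0 : c != 0 by rewrite gt_eqF.
pose F x := c^-1 *: (h x - h 0).
have FB (u v : 'rV[R]_q) : dot (F u - F v) (F u - F v) = dot (u - v) (u - v).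
  have -> : F u - F v = c^-1 *: (h u - h v).
    by rewrite -scalerBr opprB addrA subrK.
  rewrite dotZl dotC dotZl -!sqr_l2dist hc mulrA exprMn mulrA.
  by rewrite -expr2 exprVn mulVf ?mul1r// expf_neq0.
have F0 : F 0 = 0 by rewrite /F subrr scaler0.
have polar (u v : 'rV[R]_q) : dot u v = 2^-1 * (dot u u + dot v v - dot (u - v) (u - v)).
  rewrite dotDl dotNl !(dotC _ (u - v)) !dotDl !dotNl (dotC v u).
  lra.
have Fdot (u v : 'rV[R]_q) : dot (F u) (F v) = dot u v.
  rewrite polar FB [RHS]polar; congr (_ * (_ + _ - _)).
    by have := FB u 0; rewrite F0 !subr0.
  by have := FB v 0; rewrite F0 !subr0.
pose A : 'M[R]_q := \matrix_(i, j) F (delta_mx ord0 i) ord0 j.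

have dotdelta u j : dot u (delta_mx ord0 j) = u ord0 j.
  rewrite /dot (bigD1 j)//= big1 ?addr0.
    by rewrite mxE !eqxx mulr1.
  by move=> k kj; rewrite mxE (negbTE kj) andbF mulr0.
have FA u : F u *m A^T = u.
  apply/rowP => j; rewrite -[RHS]dotdelta -Fdot mxE.
  by apply: eq_bigr => k _; rewrite !mxE.
have AA : A *m A^T = 1%:M.
  apply/row_matrixP => i; rewrite row_mul row1.
  have -> : row i A = F (delta_mx ord0 i) by apply/rowP => j; rewrite !mxE.
  exact: FA.
have FE u : F u = u *m A.
  by rewrite -[in RHS](FA u) -mulmxA (mulmx1C AA) mulmx1.
exists (c^-1 *: (y - h 0) *m A^T).
have : F (c^-1 *: (y - h 0) *m A^T) = c^-1 *: (y - h 0).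
  by rewrite FE -mulmxA (mulmx1C AA) mulmx1.
by move/(scalerI (invr_neq0 cn0))/addIr.
Qed.

Lemma continuous_l2lip_map h c : 0 < c ->
  (forall x y, l2dist (h x) (h y) <= c * l2dist x y) -> continuous h.
Proof.
move=> c0 hc x; apply/(@cvgrPdist_lt _ _ _ (nbhs x)) => e e0.
have ec0 : 0 < c^-1 * e by rewrite mulr_gt0 ?invr_gt0.
apply: (@filterS _ (nbhs x) _ _ _ _ (nbhs_l2ball x ec0)) => y /= xy.
apply: le_lt_trans (norm_le_l2dist _ _) _.
by apply: le_lt_trans (hc _ _) _; rewrite -ltr_pdivlMl.
Qed.

Lemma similitude_continuous h c : similitude h c -> continuous h.
Proof. by move=> [c0 hc]; apply: (continuous_l2lip_map c0) => x y; rewrite hc. Qed.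

(** The image of a ball around [x0] is a whole ball, since similitudes are
    onto, and it avoids the other center. *)
Lemma similitude_separated (O : set 'rV[R]_q) x0 (om : R) h1 c1 h2 c2 :
  0 < om -> (forall y, l2dist x0 y < om -> O y) ->
  similitude h1 c1 -> similitude h2 c2 -> h1 @` O `&` h2 @` O = set0 ->
  om * c1 <= l2dist (h1 x0) (h2 x0).
Proof.
move=> om0 hO s1 s2 dis; rewrite leNgt; apply/negP => near.
have [y hy] := similitude_surj s1 (h2 x0).
suff : (h1 @` O `&` h2 @` O) (h2 x0) by rewrite dis.
split; last by exists x0 => //; apply: hO; rewrite l2distxx.
exists y => //; apply: hO; case: s1 => c10 s1.
by move: near; rewrite -hy s1 mulrC ltr_pM2r.
Qed.

End similitudes.

Section packing.
Variables (R : realType) (q : nat).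

(** Pigeonhole on a grid whose mesh is a fixed fraction of the separation. *)
Lemma packing (A B : R) : 0 < A -> 0 < B -> exists K : nat,
  forall (J : finType) (S : {set J}) (y : J -> 'rV[R]_q) (v : 'rV[R]_q) (be : R),
    0 < be ->
    (forall j, j \in S -> l2dist (y j) v <= A * be) ->
    (forall j k, j \in S -> k \in S -> j != k ->
      B * be <= l2dist (y j) (y k)) ->
    (#|S| <= K)%N.
Proof.
move=> A0 B0; pose L := (Num.truncn (2 * A * q.+1%:R / B)).+1.
exists #|{ffun 'I_q -> 'I_L}| => J S y v be be0 near sep.
pose side := B * be / q.+1%:R.
have side0 : 0 < side by rewrite divr_gt0 ?mulr_gt0.
pose xi j i := (y j ord0 i - v ord0 i + A * be) / side.
have xi_itv j i : j \in S -> 0 <= xi j i <= 2 * A * q.+1%:R / B.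
  move=> jS; have := le_trans (coord_le_l2dist (y j) v i) (near j jS).
  rewrite ler_norml => /andP[h1 h2]; apply/andP; split.
    by rewrite divr_ge0 ?(ltW side0)//; lra.
  rewrite ler_pdivrMr// /side.
  have -> : 2 * A * q.+1%:R / B * (B * be / q.+1%:R) = 2 * A * be.
    have : 0 < q.+1%:R :> R by [].
    by move: q.+1%:R => a a0; field; rewrite !gt_eqF.
  lra.
pose F j : {ffun 'I_q -> 'I_L} := [ffun i => inord (Num.truncn (xi j i))].
have FE j i : j \in S -> F j i = Num.truncn (xi j i) :> nat.
  move=> jS; rewrite ffunE inordK// ltnS.
  by have /andP[_] := xi_itv j i jS; apply: le_truncn.
have F_inj : {in S &, injective F}.
  move=> j k jS kS Fjk; apply/eqP/negPn/negP => jk.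
  have := sep j k jS kS jk; apply/negP; rewrite -ltNge.
  have coord i : `|y j ord0 i - y k ord0 i| <= side.
    have : Num.truncn (xi j i) = Num.truncn (xi k i).
      by rewrite -!FE// Fjk.
    have /andP[j0 _] := xi_itv j i jS; have /andP[k0 _] := xi_itv k i kS.
    have := truncn_itv j0; have := truncn_itv k0.
    move=> /andP[k1 k2] /andP[j1 j2] e; rewrite e in j1 j2.
    have : `|xi j i - xi k i| <= 1.
      rewrite -natr1 in j2 k2; rewrite ler_norml; lra.
    have -> : xi j i - xi k i = (y j ord0 i - y k ord0 i) / side.
      by rewrite /xi -mulrBl; congr (_ / _); ring.
    by rewrite normrM normfV (gtr0_norm side0) ler_pdivrMr// mul1r.
  apply: le_lt_trans (l2dist_le_sum _ _) _.
  have : \sum_i `|y j ord0 i - y k ord0 i| <= \sum_(i < q) side by exact: ler_sum.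
  move/le_lt_trans; apply; rewrite sumr_const card_ord -mulr_natr /side.
  rewrite [ltLHS]mulrAC ltr_pdivrMr// ltr_pM2l ?mulr_gt0//.
  by rewrite ltr_nat.
by rewrite -(card_in_imset F_inj) max_card.
Qed.

End packing.

(** * Farthest-point insertion *)

Section birth.
Variables (R : realType) (q n : nat) (pts : 'I_n -> 'rV[R]_q).
Local Notation dist i j := (l2dist (pts i) (pts j)).

(** A scale function [b] on finitely many points makes [{b >= t}] a net of
    mesh [t] for every scale [t] at once; the condition [separated] says that
    of two points the one inserted later was still uncovered at its scale. *)
Definition separated (S : {set 'I_n}) (b : 'I_n -> R) :=
  forall u v, u \in S -> v \in S -> u != v -> Num.min (b u) (b v) <= dist u v.

Definition nets (S : {set 'I_n}) (b : 'I_n -> R) (tau T : R) :=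
  forall t, tau <= t <= T -> forall x, exists v,
    [/\ v \in S, t <= b v & dist x v <= t].

(** The next point is the one farthest from [S], and its scale [tau'] is that
    distance.  All points are then within [tau'] of [S], so the net property
    descends from [tau] to [tau']. *)
Lemma birth_extend (T : R) k : forall (S : {set 'I_n}) (tau : R) (b : 'I_n -> R),
  (#|~: S| <= k)%N -> S != finset.set0 -> 0 <= tau <= T ->
  (forall u, u \in S -> tau <= b u) -> separated S b -> nets S b tau T ->
  exists b', separated (finset.setTfor 'I_n) b' /\ nets (finset.setTfor 'I_n) b' 0 T.
Proof.
elim: k => [|k IH] S tau b Sk /set0Pn[u0 u0S] /andP[tau0 tauT] btau sep net.
  have SC : S = finset.setTfor 'I_n.
    apply/setP => x; rewrite inE; apply/negPn/negP => xS.
    by move: Sk; rewrite leqn0 cards_eq0 => /eqP/setP/(_ x); rewrite !inE xS.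
  exists b; rewrite -SC; split=> // t /andP[t0 tT] x.
  have [taut|ttau] := leP tau t; first by apply: net; rewrite taut.
  have xS : x \in S by rewrite SC inE.
  by exists x; rewrite xS l2distxx t0 (le_trans (ltW ttau) (btau _ xS)).
have [/forallP SC|/forallPn[x0 x0S]] := boolP [forall x, x \in S].
  apply: (IH S tau b) => //; [|by apply/set0Pn; exists u0|by rewrite tau0].
  suff -> : ~: S = finset.set0 by rewrite cards0.
  by apply/setP => x; rewrite !inE SC.
pose N x := [arg min_(v < u0 | v \in S) dist x v]%O.
have NP x : N x \in S /\ forall v, v \in S -> dist x (N x) <= dist x v.
  by rewrite /N; case: arg_minP => // v vS vmin; split.
pose x1 := [arg max_(x > x0 | x \notin S) dist x (N x)]%O.
have [x1S x1max] : x1 \notin S /\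
    forall x, x \notin S -> dist x (N x) <= dist x1 (N x1).
  by rewrite /x1; case: arg_maxP => // v vS vmax; split.
pose tau' := dist x1 (N x1).
have tau'_le : tau' <= tau.
  have [|v [vS _ x1v]] := net tau _ x1; first by rewrite lexx.
  exact: le_trans ((NP x1).2 v vS) x1v.
have neq u : u \in S -> (u == x1) = false.
  by move=> uS; apply: contraNF x1S => /eqP <-.
pose b' u := if u == x1 then tau' else b u.
apply: (IH (x1 |: S)%SET tau' b').
- rewrite -ltnS; apply: leq_trans Sk; apply: proper_card.
  rewrite properE; apply/andP; split.
    by apply/fintype.subsetP => x; rewrite !inE negb_or => /andP[].
  by apply/subsetPn; exists x1; rewrite !inE ?eqxx.
- by apply/set0Pn; exists x1; rewrite !inE eqxx.
- by rewrite l2dist_ge0 (le_trans tau'_le).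
- move=> u; rewrite !inE /b'; case: eqP => //= _ uS.
  exact: le_trans tau'_le (btau _ uS).
- have sep1 v : v \in S -> Num.min tau' (b v) <= dist x1 v.
    by move=> vS; rewrite ge_min (NP x1).2.
  move=> u v; rewrite !inE /b'; case: eqP => [->|_] /=; case: eqP => [->|_] //=.
  + by rewrite eqxx.
  + by move=> _ vS _; exact: sep1.
  + by move=> uS _ _; rewrite minC l2distC; exact: sep1.
  + exact: sep.
- move=> t /andP[tau't tT] x; have [taut|/ltW ttau] := leP tau t.
    have [|v [vS tv xv]] := net t _ x; first by rewrite taut.
    by exists v; rewrite !inE vS orbT /b' neq.
  have [xS|xS] := boolP (x \in S).
    exists x; rewrite !inE xS orbT /b' neq// l2distxx (le_trans ttau (btau _ xS)).
    by rewrite (le_trans _ tau't)// l2dist_ge0.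
  exists (N x); have [NS _] := NP x; rewrite !inE NS orbT /b' neq//.
  by rewrite (le_trans ttau (btau _ NS)) (le_trans (x1max _ xS)).
Qed.

(** The insertion starts at an arbitrary point with a scale that exceeds the
    diameter, where a single point is a net. *)
Lemma birth_scales (T : R) : (0 < n)%N -> 0 <= T -> exists b : 'I_n -> R,
  separated (finset.setTfor 'I_n) b /\ nets (finset.setTfor 'I_n) b 0 T.
Proof.
move=> n0 T0; pose i0 := Ordinal n0.
pose T' := Num.max T (\sum_x dist x i0).
have TT' : T <= T' by rewrite le_max lexx.
have [] := @birth_extend T' #|~: [set i0]%SET| [set i0]%SET T' (fun=> T').
- by [].
- by apply/set0Pn; exists i0; rewrite inE.
- by rewrite lexx (le_trans T0).
- by [].
- by move=> u v; rewrite !inE => /eqP-> /eqP->; rewrite eqxx.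
- move=> t /andP[t1 t2] x; exists i0; rewrite inE eqxx t2; split=> //.
  apply: le_trans t1; rewrite le_max (bigD1 x)//= lerDl sumr_ge0 ?orbT//.
  by move=> *; exact: l2dist_ge0.
- move=> b [sepb netb]; exists b; split=> // t /andP[t0 tT] x.
  by apply: netb; rewrite t0 (le_trans tT).
Qed.

End birth.

(** * Copies crowded by a finite set of points *)

Section crowded.
Variables (R : realType) (q : nat).

(** At the scale [rho] of the copy [h], the points near it do not look like a
    single point. *)
Definition crowded (D eta : R) n (pts : 'I_n -> 'rV[R]_q)
    (h : 'rV[R]_q -> 'rV[R]_q) (rho : R) :=
  exists a b, [/\ l2dist (pts a) (h 0) <= D * rho,
    l2dist (pts b) (h 0) <= D * rho & eta * rho <= l2dist (pts a) (pts b)].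

(** The bound is linear in the number of points although a point may lie near
    copies of infinitely many scales.  The net at a small fraction of the scale
    [rho] contains distinct points near the two given ones.  The one inserted
    later has a scale at most their distance, and as a point of the net at
    least that fraction of [rho].  Each point has one insertion scale, and only
    boundedly many disjoint copies of a comparable size fit near it. *)
Lemma card_crowded (O : set 'rV[R]_q) (D eta : R) :
  open O -> O !=set0 -> 0 < D -> 0 < eta -> exists C : nat,
  forall n (pts : 'I_n -> 'rV[R]_q) (J : finType)
    (h : J -> 'rV[R]_q -> 'rV[R]_q) (rho : J -> R),
    (forall j, similitude (h j) (rho j) /\ rho j <= 1) ->
    (forall j k, j != k -> h j @` O `&` h k @` O = set0) ->
    (#|[set j | `[< crowded D eta pts (h j) (rho j) >]]%SET| <= n * C)%N.
Proof.
move=> oO [x0 Ox0] D0 eta0; have [om om0 hO] := openP_l2 oO Ox0.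
pose c1 := eta / 4; pose c2 := 2 * D + eta / 2.
have c10 : 0 < c1 by rewrite divr_gt0.
have c20 : 0 < c2 by rewrite addr_gt0 ?mulr_gt0 ?divr_gt0.
have d0 : 0 <= l2dist 0 x0 by exact: l2dist_ge0.
pose A := (D + c1 + l2dist 0 x0) / c1; pose B := om / c2.
have A0 : 0 < A by rewrite divr_gt0// ltr_pwDl// addr_gt0.
have B0 : 0 < B by rewrite divr_gt0.
have [K packK] := packing q A0 B0.
exists K => n pts J h rho sim dis; set S := [set j | _]%SET.
have [n0|n0] := posnP n.
  suff -> : S = finset.set0 by rewrite cards0.
  apply/setP => j; rewrite !inE; apply/asboolP => -[a _]; have := ltn_ord a.
  by rewrite {2}n0.
have [b [sepb netb]] := birth_scales pts n0 (ltW eta0).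
have rho0 j : 0 < rho j by have [[]] := sim j.
have charge j : j \in S -> exists v, [/\ c1 * rho j <= b v, b v <= c2 * rho j &
    l2dist (pts v) (h j 0) <= (D + c1) * rho j].
  rewrite inE => /asboolP[x [y [xj yj xy]]]; pose t := c1 * rho j.
  have t0 : 0 < t by rewrite mulr_gt0.
  have tT : 0 <= t <= eta.
    rewrite ltW//= /t /c1; have := sim j => -[_ r1].
    have : eta * rho j <= eta by rewrite ger_pMr.
    have := mulr_gt0 eta0 (rho0 j); lra.
  have [u [_ tu xu]] := netb t tT x; have [v [_ tv yv]] := netb t tT y.
  have et : eta * rho j = 4 * t by rewrite /t /c1; field.
  have Dt : (D + c1) * rho j = D * rho j + t by rewrite /t mulrDl.
  have c2t : c2 * rho j = 2 * (D * rho j) + 2 * t.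
    by rewrite /t /c2 /c1; field.
  have uv : u != v.
    apply/eqP => e; rewrite -e in yv.
    have := l2dist_triangle (pts u) (pts x) (pts y).
    by rewrite (l2distC (pts u)); lra.
  have uj : l2dist (pts u) (h j 0) <= (D + c1) * rho j.
    have := l2dist_triangle (pts x) (pts u) (h j 0).
    by rewrite (l2distC (pts u) (pts x)); lra.
  have vj : l2dist (pts v) (h j 0) <= (D + c1) * rho j.
    have := l2dist_triangle (pts y) (pts v) (h j 0).
    by rewrite (l2distC (pts v) (pts y)); lra.
  have uvc : l2dist (pts u) (pts v) <= c2 * rho j.
    have := l2dist_triangle (h j 0) (pts u) (pts v).
    by rewrite (l2distC (h j 0)); lra.
  have := sepb u v; rewrite !inE => /(_ isT isT uv).
  by rewrite ge_min => /orP[h1|h1]; [exists u|exists v]; split=> //;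
    apply: le_trans h1 uvc.
have /choice[f fP] : forall j, exists v : 'I_n, j \in S ->
    [/\ c1 * rho j <= b v, b v <= c2 * rho j &
    l2dist (pts v) (h j 0) <= (D + c1) * rho j].
  move=> j; have [/charge[v]|] := boolP (j \in S); first by exists v.
  by exists (Ordinal n0).
rewrite -sum1_card (partition_big f xpredT)//=.
suff le v : (\sum_(j in S | f j == v) 1 <= K)%N.
  by apply: leq_trans (leq_sum _ (fun v _ => le v)) _; rewrite sum_nat_const card_ord.
pose Sv := [set j in S | f j == v]%SET.
have -> : (\sum_(j in S | f j == v) 1 = #|Sv|)%N.
  by rewrite -sum1_card; apply: eq_bigl => j; rewrite !inE.
have [-> |/set0Pn[j0 j0S]] := eqVneq Sv finset.set0; first by rewrite cards0.
have SvP j : j \in Sv -> [/\ c1 * rho j <= b v, b v <= c2 * rho j &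
    l2dist (pts v) (h j 0) <= (D + c1) * rho j].
  by rewrite inE => /andP[jS /eqP <-]; exact: fP.
apply: (packK J Sv (fun j => h j x0) (pts v) (b v)).
- by have [h1 _ _] := SvP j0 j0S; apply: lt_le_trans h1; rewrite mulr_gt0.
- move=> j jS; have [h1 _ h3] := SvP j jS; have [[_ simj] _] := sim j.
  have := l2dist_triangle (h j 0) (h j x0) (pts v).
  rewrite simj (l2distC x0) (l2distC (h j 0)) => h4; apply: (le_trans h4).
  have -> : A * b v = (D + c1 + l2dist 0 x0) * (b v / c1).
    by rewrite /A mulrAC mulrA.
  have : rho j <= b v / c1 by rewrite ler_pdivlMr// mulrC.
  move=> rb; apply: le_trans (_ : (D + c1 + l2dist 0 x0) * rho j <= _).
    by rewrite (mulrDl _ (l2dist 0 x0)) mulrC [leRHS]addrC lerD// mulrC.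
  by rewrite ler_wpM2l// addr_ge0// addr_ge0 ?ltW.
- move=> j k jS kS jk; have [_ h2 _] := SvP j jS.
  have [sj _] := sim j; have [sk _] := sim k.
  apply: le_trans (similitude_separated om0 hO sj sk (dis j k jk)).
  by rewrite /B -mulrA ler_pM2l// ler_pdivrMl.
Qed.

End crowded.

(** * Mixtures of images of measures *)

Section mixtures.
Variables (R : realType) (q : nat).
Implicit Types (P : probability (borel_rV R q) R) (phi : 'rV[R]_q -> R).
Local Notation T := (borel_rV R q).

Lemma measurable_open (O : set 'rV[R]_q) : open O -> measurable (O : set T).
Proof. by move=> oO; exact: sub_sigma_algebra. Qed.

Lemma prob_mono P (A B : set T) : measurable A -> measurable B -> A `<=` B ->
  (P A <= P B)%E.
Proof. by move=> mA mB; apply: le_measure; exact: mem_set. Qed.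

Lemma measurable_continuous phi : continuous phi ->
  measurable_fun [set: T] (phi : T -> R).
Proof.
move=> cphi.
apply: (measurability _ (@RGenOpens.measurableE R)) => _ [_ [a [b ->]] <-].
rewrite setTI; apply: measurable_open; apply: open_comp; last exact: interval_open.
by move=> x _; exact: cphi.
Qed.

Lemma measurable_continuous_map (h : 'rV[R]_q -> 'rV[R]_q) : continuous h ->
  measurable_fun [set: T] (h : T -> T).
Proof.
move=> ch; apply: (@measurability _ _ T T setT h (@open 'rV[R]_q)) => // _ [V oV <-].
rewrite setTI; apply: measurable_open; exact: open_comp.
Qed.

(** Both the self-similar equation, with [Q i = P] for all [i], and the
    condensation equation, where one component is a given measure carried by
    the identity map, have this form. *)
Definition mixture n (w : 'I_n -> R) (h : 'I_n -> 'rV[R]_q -> 'rV[R]_q)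
    (Q : 'I_n -> probability T R) P :=
  forall A : set T, measurable A ->
    P A = (\sum_(i < n) (w i)%:E * Q i (h i @^-1` A))%E.

Lemma integral_mixture n (w : 'I_n -> R) h Q P phi :
  (forall i, 0 <= w i) -> (forall i, continuous (h i)) -> mixture w h Q P ->
  measurable_fun [set: T] (phi : T -> R) -> (forall x, 0 <= phi x) ->
  (\int[P]_x (phi x)%:E =
   \sum_(i < n) (w i)%:E * \int[Q i]_x (phi (h i x))%:E)%E.
Proof.
move=> w0 ch mixP /measurable_EFinP mphi phi0.
have mh i := measurable_continuous_map (ch i).
pose hm i : {mfun T >-> T} := HB.pack (h i : T -> T)
  (isMeasurableFun.Build _ _ _ _ _ (mh i)).
pose m k : {measure set T -> \bar R} := if insub k is Some i
  then mscale (NngNum (w0 i)) (distribution (Q i) (hm i)) else mzero.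
have mE (i : 'I_n) : m i = mscale (NngNum (w0 i)) (distribution (Q i) (hm i)).
  by rewrite /m valK.
rewrite (eq_measure_integral (msum m n)); last first.
  move=> A mA _; apply: etrans (mixP A mA) _.
  by apply: eq_bigr => i _; rewrite mE.
rewrite ge0_integral_measure_sum//; last by move=> x _; rewrite lee_fin.
apply: eq_bigr => i _; rewrite mE ge0_integral_mscale//; last first.
  by move=> x _; rewrite lee_fin.
by rewrite ge0_integral_distribution.
Qed.

(** An inequality is what holds for [mu] and the maps [f i] alone, to which
    [nu] adds its own contribution; it suffices for lower bounds. *)
Definition dominates n (w : 'I_n -> R) (h : 'I_n -> 'rV[R]_q -> 'rV[R]_q)
    (Q : 'I_n -> probability T R) (mu : probability T R) :=
  forall phi, measurable_fun [set: T] (phi : T -> R) -> (forall x, 0 <= phi x) ->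
    (\sum_(i < n) (w i)%:E * \int[Q i]_x (phi (h i x))%:E
      <= \int[mu]_x (phi x)%:E)%E.

Lemma mixture_dominates n (w : 'I_n -> R) h Q P :
  (forall i, 0 <= w i) -> (forall i, continuous (h i)) -> mixture w h Q P ->
  dominates w h Q P.
Proof.
by move=> w0 ch mixP phi mphi phi0; rewrite (integral_mixture w0 ch mixP mphi phi0).
Qed.

End mixtures.

(** * Distance to a set, and measures with bounded support *)

Lemma exprn_lt_exists (R : realType) (c e : R) : 0 < c < 1 -> 0 < e ->
  exists k, c ^+ k < e.
Proof.
move=> /andP[c0 c1] e0; have nc : `|c| < 1 by rewrite gtr0_norm.
have /cvgrPdist_lt/(_ e e0)[k _ /(_ k)] := cvg_expr nc.
move=> /(_ (leqnn k)); rewrite sub0r normrN gtr0_norm ?exprn_gt0// => h.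
by exists k.
Qed.

Section distance_to_set.
Variables (R : realType) (q : nat).
Implicit Types (x y z : 'rV[R]_q) (a b : set 'rV[R]_q).
Local Notation T := (borel_rV R q).

Lemma has_lbound_l2dist x a : has_lbound [set l2dist x y | y in a].
Proof. by exists 0 => _ [y _ <-]; exact: l2dist_ge0. Qed.

Lemma l2dist_set_le x y a : a y -> l2dist_set x a <= l2dist x y.
Proof. by move=> ay; apply: ge_inf; [exact: has_lbound_l2dist|exists y]. Qed.

Lemma l2dist_set_ge x a (c : R) : a !=set0 ->
  (forall y, a y -> c <= l2dist x y) -> c <= l2dist_set x a.
Proof.
move=> [y ay] h; apply: lb_le_inf; first by exists (l2dist x y), y.
by move=> _ [z az <-]; exact: h.
Qed.

Lemma l2dist_set_ge0 x a : 0 <= l2dist_set x a.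
Proof.
have [->|a0] := eqVneq a set0; first by rewrite /l2dist_set image_set0 inf0.
by apply: l2dist_set_ge; [exact/set0P|move=> y _; exact: l2dist_ge0].
Qed.

Lemma l2dist_set_lip x y a : a !=set0 ->
  l2dist_set x a <= l2dist x y + l2dist_set y a.
Proof.
move=> a0; rewrite -lerBlDl; apply: l2dist_set_ge => // z az.
by rewrite lerBlDl (le_trans (l2dist_set_le _ az))// l2dist_triangle.
Qed.

Lemma l2dist_set_continuous a : a !=set0 -> continuous (fun x => l2dist_set x a).
Proof.
move=> a0; apply: (@continuous_l2lip _ _ _ 1) => // x y; rewrite mul1r ler_norml.
have := l2dist_set_lip x y a0; have := l2dist_set_lip y x a0.
by rewrite (l2distC y x); lra.
Qed.

Lemma measurable_l2dist_set a (r : R) : a !=set0 ->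
  measurable_fun [set: T] (fun x : T => l2dist_set x a `^ r).
Proof.
move=> a0; apply: (measurableT_comp (measurable_powR r)).
by apply: measurable_continuous; exact: l2dist_set_continuous.
Qed.

Lemma le_l2dist_set x a b : a !=set0 -> a `<=` b ->
  l2dist_set x b <= l2dist_set x a.
Proof.
by move=> a0 ab; apply: l2dist_set_ge => // y /ab; exact: l2dist_set_le.
Qed.

Lemma l2dist_set_image x a (h : 'rV[R]_q -> 'rV[R]_q) c : a !=set0 ->
  similitude h c -> l2dist_set (h x) (h @` a) = c * l2dist_set x a.
Proof.
move=> [y0 ay0] [c0 hc]; apply/eqP; rewrite eq_le; apply/andP; split.
  rewrite mulrC -ler_pdivrMr//; apply: l2dist_set_ge; first by exists y0.
  move=> y ay; rewrite ler_pdivrMr// mulrC -hc.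
  by apply: l2dist_set_le; exists y.
apply: l2dist_set_ge; first by exists (h y0), y0.
by move=> _ [y ay <-]; rewrite hc ler_pM2l// l2dist_set_le.
Qed.

Lemma open_l2tail (rad : R) : open [set x : 'rV[R]_q | rad < l2dist 0 x].
Proof.
rewrite openE => x /= radx; have e0 : 0 < l2dist 0 x - rad by rewrite subr_gt0.
apply: (@filterS _ (nbhs x) _ _ _ _ (nbhs_l2ball x e0)) => y /= xy.
by have := l2dist_triangle y 0 x; rewrite (l2distC y x); lra.
Qed.

End distance_to_set.

Section bounded_measures.
Variables (R : realType) (q : nat).
Local Notation T := (borel_rV R q).
Implicit Types P : probability T R.

Definition l2tail (rad : R) : set T := [set x | rad < l2dist 0 x].

Lemma measurable_l2tail rad : measurable (l2tail rad).
Proof. by apply: measurable_open; exact: open_l2tail. Qed.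

Definition bounded_measure P := exists rad : R, P (l2tail rad) = 0%E.

Lemma bounded_measureW P : bounded_measure P ->
  exists2 rad : R, 0 < rad & P (l2tail rad) = 0%E.
Proof.
move=> [rad rad0]; exists (Num.max 1 rad); first by rewrite lt_max ltr01.
apply/eqP; rewrite -measure_le0 -rad0; apply: prob_mono.
- exact: measurable_l2tail.
- exact: measurable_l2tail.
- by move=> x /=; rewrite /l2tail /= gt_max => /andP[].
Qed.

Lemma l2tail_cvg P : P (l2tail k%:R) @[k --> \oo] --> 0%E.
Proof.
have cap0 : \bigcap_k l2tail k%:R = set0.
  apply/seteqP; split=> // x h.
  have := h (Num.truncn (l2dist 0 x)).+1 I.
  rewrite /l2tail /= ltNge => /negP; apply; apply: ltW.
  by have /andP[] := truncn_itv (l2dist_ge0 0 x).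
rewrite -(@measure0 _ _ _ P) -cap0.
apply: (@nonincreasing_cvg_mu _ _ _ P (fun k => l2tail k%:R)).
- exact: le_lt_trans (probability_le1 _ (measurable_l2tail _)) (ltry 1).
- by move=> k; exact: measurable_l2tail.
- by rewrite cap0.
- move=> m n mn; apply/subsetPset => x /=; rewrite /l2tail /=.
  by apply: le_lt_trans; rewrite ler_nat.
Qed.

(** Outside a ball that contains the bounded components and
    is mapped into itself by the contractions, the tail mass at radius
    [rad0 + u] is at most the tail mass at radius [rad0 + u / c]; iterate. *)
Lemma mixture_bounded n (w : 'I_n -> R) h (Q : 'I_n -> probability T R) P c :
  mixture w h Q P -> probability_vector w -> 0 < c < 1 ->
  (forall i, (Q i = P /\ forall x, l2dist (h i 0) (h i x) <= c * l2dist 0 x) \/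
    exists rad, Q i (h i @^-1` l2tail rad) = 0%E) ->
  (forall i, continuous (h i)) ->
  bounded_measure P.
Proof.
move=> mixP [w0 w1] /andP[c0 c1] Qh ch.
have mh i (A : set T) : measurable A -> measurable (h i @^-1` A : set T).
  move=> mA; rewrite -[X in measurable X]setTI.
  exact: (measurable_continuous_map (ch i)).
have /choice[rad Qrad] : forall i, exists rad,
    (Q i = P /\ forall x, l2dist (h i 0) (h i x) <= c * l2dist 0 x) \/
    Q i (h i @^-1` l2tail rad) = 0%E.
  by move=> i; have [h1|[x h1]] := Qh i; [exists 0; left|exists x; right].
pose b := \sum_i l2dist 0 (h i 0); pose rad0 := b / (1 - c) + \sum_i `|rad i|.
have b0 i : l2dist 0 (h i 0) <= b.
  by rewrite /b (bigD1 i)//= lerDl sumr_ge0// => j _; exact: l2dist_ge0.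
have s0 i : rad i <= \sum_i `|rad i|.
  by rewrite (bigD1 i)//= (le_trans (ler_norm _))// lerDl sumr_ge0.
have step u : 0 < u -> (P (l2tail (rad0 + u)) <= P (l2tail (rad0 + u / c)))%E.
  move=> u0; rewrite mixP; last exact: measurable_l2tail.
  have -> : P (l2tail (rad0 + u / c)) =
      (\sum_i (w i)%:E * P (l2tail (rad0 + u / c)))%E.
    rewrite -ge0_sume_distrl; last by move=> i _; rewrite lee_fin.
    by rewrite sumEFin w1 mul1e.
  apply: lee_sum => i _; apply: lee_wpmul2l; first by rewrite lee_fin.
  have [[-> hc]|Q0] := Qrad i.
    apply: prob_mono.
    - by apply: mh; exact: measurable_l2tail.
    - exact: measurable_l2tail.
    move=> x /=; rewrite /l2tail /= => hx.
    have := l2dist_triangle (h i 0) 0 (h i x); have := hc x; have := b0 i.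
    have bc : b = (1 - c) * (b / (1 - c)) by field; lra.
    have : 0 <= \sum_i `|rad i| by apply: sumr_ge0.
    have : 0 <= b / (1 - c).
      rewrite divr_ge0//; last by lra.
      by apply: sumr_ge0 => j _; exact: l2dist_ge0.
    move: hx; rewrite /rad0; move: (\sum_i `|rad i|) => s hx.
    move: bc hx; set e := b / (1 - c) => bc hx e0 s1 h1 h2 h3.
    have : c * (e + s + u / c) < c * l2dist 0 x.
      have -> : c * (e + s + u / c) = c * e + c * s + u by field; lra.
      have : c * s <= s by rewrite ler_piMl// ltW.
      lra.
    by rewrite ltr_pM2l.
  suff -> : Q i (h i @^-1` l2tail (rad0 + u)) = 0%E by exact: measure_ge0.
  apply/eqP; rewrite -measure_le0 -Q0; apply: prob_mono.
  - by apply: mh; exact: measurable_l2tail.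
  - by apply: mh; exact: measurable_l2tail.
  move=> x; rewrite /l2tail /=; apply: le_lt_trans.
  have := s0 i; have : 0 <= b / (1 - c).
    rewrite divr_ge0//; last by lra.
    by apply: sumr_ge0 => j _; exact: l2dist_ge0.
  rewrite /rad0; lra.
have iter k : (P (l2tail (rad0 + 1)) <= P (l2tail (rad0 + c^-1 ^+ k)))%E.
  elim: k => [|k IH]; first by rewrite expr0.
  rewrite (le_trans IH)// exprSr; apply: step.
  by rewrite exprn_gt0 ?invr_gt0.
exists (rad0 + 1); apply/eqP; rewrite -measure_le0.
rewrite -(cvg_lim _ (l2tail_cvg P))//.
apply: lime_ge; first by apply/cvg_ex; exists 0%E; exact: l2tail_cvg.
apply: nearW => k; have [m cm] : exists m, c ^+ m < (k%:R + 1 + `|rad0|)^-1.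
  by apply: exprn_lt_exists; rewrite ?c0// invr_gt0 ltr_wpDr// ltr_wpDl.
apply: le_trans (iter m) _; apply: prob_mono.
- exact: measurable_l2tail.
- exact: measurable_l2tail.
move=> x; rewrite /l2tail /=; apply: le_lt_trans.
have : k%:R + 1 + `|rad0| < c^-1 ^+ m.
  by rewrite exprVn -[ltLHS]invrK ltf_pV2 ?posrE ?invr_gt0 ?exprn_gt0//
    ltr_wpDr// ltr_wpDl.
have := ler_norm (- rad0); rewrite normrN; lra.
Qed.

End bounded_measures.

(** * Support and spread of a measure *)

Section support.
Variables (R : realType) (q : nat).
Local Notation T := (borel_rV R q).
Implicit Types P : probability T R.

Lemma bounded_moment P (r : R) : 0 < r -> bounded_measure P -> exists2 D : R,
  0 <= D & (\int[P]_x (l2dist_set x [set 0] `^ r)%:E <= D%:E)%E.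
Proof.
move=> r0 /bounded_measureW[rad rad0 Prad].
exists (rad `^ r); first exact: powR_ge0.
have -> : ((rad `^ r)%:E = \int[P]_x (cst (rad `^ r)%:E) x)%E.
  by rewrite integral_cst// [X in (_ * X)%E](@probability_setT _ _ _ P) mule1.
apply: ae_ge0_le_integral => //.
- by move=> x _; rewrite lee_fin powR_ge0.
- apply/measurable_EFinP; apply: measurable_l2dist_set.
  by exists 0.
- by move=> x _; rewrite lee_fin powR_ge0.
- exists (l2tail rad); split=> //; first exact: measurable_l2tail.
  move=> x /=; apply: contra_notP => /negP; rewrite -leNgt => xrad _.
  rewrite lee_fin; apply: ge0_ler_powR; rewrite ?nnegrE ?l2dist_set_ge0 ?(ltW r0) ?(ltW rad0)//.
  apply: le_trans xrad; rewrite l2distC.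
  by apply: l2dist_set_le.
Qed.

Lemma not_msupport P x : ~ msupport P x ->
  exists V : set 'rV[R]_q, [/\ open V, V x & P V = 0%E].
Proof.
move=> /existsNP[V] /not_implyP[oV] /not_implyP[Vx] /negP.
rewrite -leNgt => P0; exists V; split=> //; apply/eqP.
by rewrite -measure_le0.
Qed.

Lemma closed_msupport P : closed (msupport P).
Proof.
rewrite -openC openE => x /not_msupport[V [oV Vx V0]].
apply: (@filterS _ (nbhs x) _ V); last exact: open_nbhs_nbhs.
by move=> y Vy /(_ V oV Vy); rewrite V0 ltxx.
Qed.

Lemma msupport_bounded P : bounded_measure P ->
  exists rad : R, forall x, msupport P x -> l2dist 0 x <= rad.
Proof.
move=> [rad Prad]; exists rad => x Px; rewrite leNgt; apply/negP => radx.
by have := Px _ (@open_l2tail R q rad) radx; rewrite -[X in P X]/(l2tail rad) Prad ltxx.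
Qed.

Lemma bounded_set_l2 (A : set 'rV[R]_q) (rad : R) :
  (forall x, A x -> l2dist 0 x <= rad) -> bounded_set A.
Proof.
move=> Arad; exists rad; split; first exact: num_real.
move=> b radb x Ax; apply: le_trans (ltW radb); apply: le_trans (Arad x Ax).
by rewrite -[x in leLHS]subr0 l2distC norm_le_l2dist.
Qed.

Lemma compact_msupport P : bounded_measure P -> compact (msupport P).
Proof.
move=> /msupport_bounded[rad h].
by apply: bounded_closed_compact; [exact: bounded_set_l2 h|exact: closed_msupport].
Qed.

(** Null neighbourhoods of all points would give, by compactness, a ball of
    measure zero that carries the whole mass. *)
Lemma msupport_neq0 P : bounded_measure P -> msupport P !=set0.
Proof.
move=> [rad Prad]; apply/set0P/negP => /eqP supp0.
have /choice[V VP] x : exists V : set 'rV[R]_q, [/\ open V, V x & P V = 0%E].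
  by apply: not_msupport; rewrite supp0.
pose K := ~` (l2tail rad) : set 'rV[R]_q.
have cK : compact K.
  apply: bounded_closed_compact.
    by apply: (@bounded_set_l2 _ rad) => x /negP; rewrite -leNgt.
  by apply: open_closedC; exact: open_l2tail.
move: cK; rewrite compact_cover => /(_ 'rV[R]_q setT V)[].
- by move=> x _; have [] := VP x.
- by move=> x _; exists x => //; have [] := VP x.
move=> D _ KD.
have PK : P K = 0%E.
  apply/eqP; rewrite -measure_le0.
  have := @content_sub_fsum _ _ _ P _ [set` D] K V (finite_fset D).
  rewrite fsbig1; last by move=> x _; have [] := VP x.
  apply => //.
  - by move=> x _; apply: measurable_open; have [] := VP x.
  - by apply: measurableC; exact: measurable_l2tail.
have := probability_setC P (@measurable_l2tail R q rad).
by rewrite Prad sube0 -[X in P X]/K PK => /eqP; rewrite eq_sym onee_eq0.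
Qed.

Lemma mixture_msupport n (w : 'I_n -> R) h (Q : 'I_n -> probability T R) P i x :
  mixture w h Q P -> (forall j, 0 <= w j) -> 0 < w i -> continuous (h i) ->
  msupport (Q i) x -> msupport P (h i x).
Proof.
move=> mixP w0 wi ch suppx V oV Vx.
rewrite mixP; last exact: measurable_open.
rewrite (bigD1 i)//=; apply: lt_le_trans (leeDl _ _).
  rewrite mule_gt0 ?lte_fin//; apply: suppx => //.
  by apply: open_comp => // y _; exact: ch.
by apply: sume_ge0 => j _; rewrite mule_ge0 ?lee_fin.
Qed.

(** A uniform form of not being a point mass: whatever [z], the mass [del]
    lies away from [z], and it does so inside a fixed ball. *)
Definition spread P (rad eta del : R) :=
  [/\ 0 < rad, 0 < eta, 0 < del & forall z : 'rV[R]_q,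
   (del%:E <= P [set y | (l2dist 0 y < rad)%R /\ (2 * eta < l2dist z y)%R])%E].

Lemma measurable_spread_set (rad eta : R) (z : 'rV[R]_q) :
  measurable ([set y | l2dist 0 y < rad /\ 2 * eta < l2dist z y] : set T).
Proof.
apply: measurable_open; apply: openI; first exact: open_l2ball.
rewrite openE => x /= zx; have e0 : 0 < l2dist z x - 2 * eta by rewrite subr_gt0.
apply: (@filterS _ (nbhs x) _ _ _ _ (nbhs_l2ball x e0)) => y /= xy.
by have := l2dist_triangle y z x; rewrite (l2distC y x); lra.
Qed.

Lemma spread_two_points P x y : msupport P x -> msupport P y -> x != y ->
  exists rad eta del, spread P rad eta del.
Proof.
move=> Px Py xy; pose d := l2dist x y.
have d0 : 0 < d.
  by rewrite lt_neqAle l2dist_ge0 andbT eq_sym; apply: contra_neq xy => /l2dist_eq0.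
have d40 : 0 < d / 4 by rewrite divr_gt0.
have open_ball z : open [set y : 'rV[R]_q | l2dist z y < d / 4].
  exact: open_l2ball.
have PB z : P [set y | l2dist z y < d / 4] \is a fin_num.
  by apply: fin_num_measure; exact: measurable_open.
have pos z : msupport P z -> 0 < fine (P [set y | l2dist z y < d / 4]).
  move=> Pz; rewrite fine_gt0//; apply/andP; split.
    by apply: Pz => //=; rewrite l2distxx.
  by rewrite ltey_eq PB.
exists (l2dist 0 x + l2dist 0 y + d), (d / 8).
exists (Num.min (fine (P [set z | l2dist x z < d / 4]))
  (fine (P [set z | l2dist y z < d / 4]))).
have dx := l2dist_ge0 0 x; have dy := l2dist_ge0 0 y.
split.
- by lra.
- by rewrite divr_gt0.
- by rewrite lt_min !pos.
move=> z.
suff h u : (u = x \/ u = y) -> d / 2 <= l2dist z u ->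
  (P [set y0 | (l2dist u y0 < d / 4)%R] <=
   P [set y0 | (l2dist 0 y0 < l2dist 0 x + l2dist 0 y + d)%R /\
      (2 * (d / 8) < l2dist z y0)%R])%E.
  have [zx|zx] := leP (d / 2) (l2dist z x).
    apply: le_trans (h x (or_introl erefl) zx).
    by rewrite -[leRHS]fineK ?PB// lee_fin ge_min lexx.
  have zy : d / 2 <= l2dist z y.
    have := l2dist_triangle z x y; rewrite (l2distC x z) -/d; lra.
  apply: le_trans (h y (or_intror erefl) zy).
  by rewrite -[leRHS]fineK ?PB// lee_fin ge_min lexx orbT.
move=> uxy zu; apply: prob_mono.
- by apply: measurable_open; exact: open_ball.
- exact: measurable_spread_set.
move=> v /= uv; split.
  have := l2dist_triangle u 0 v.
  by move: uv; case: uxy => ->; lra.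
have := l2dist_triangle v z u; rewrite (l2distC v u); lra.
Qed.

Lemma mixture_spread n (w : 'I_n -> R) h (Q : 'I_n -> probability T R) P i
    rad eta del :
  mixture w h Q P -> (forall j, 0 <= w j) -> 0 < w i -> h i = id ->
  spread (Q i) rad eta del -> spread P rad eta (w i * del).
Proof.
move=> mixP w0 wi hi [rad0 eta0 del0 h1]; split=> //; first exact: mulr_gt0.
move=> z; rewrite mixP; last exact: measurable_spread_set.
rewrite (bigD1 i)//= -[leLHS]adde0; apply: leeD.
  by rewrite EFinM hi; apply: lee_wpmul2l; [rewrite lee_fin|exact: h1].
by apply: sume_ge0 => j _; rewrite mule_ge0 ?lee_fin.
Qed.

End support.

(** * Packings by similar copies of a measure *)

Section common_fixpoint.
Variables (R : realType) (q : nat) (O : set 'rV[R]_q).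
Hypotheses (oO : open O) (O0 : O !=set0).

Lemma image_comp_disjoint (h H1 H2 : 'rV[R]_q -> 'rV[R]_q) c (A : set 'rV[R]_q) :
  similitude h c -> H1 @` A `&` H2 @` A = set0 ->
  (h \o H1) @` A `&` (h \o H2) @` A = set0.
Proof.
move=> /similitude_inj hI dis; apply/seteqP; split=> // y [[u Ou uy] [v Ov vy]].
suff : (H1 @` A `&` H2 @` A) (H1 u) by rewrite dis.
by split; [exists u|exists v => //; apply: hI; rewrite [LHS]vy -uy].
Qed.

Lemma subset_disjoint (A B A' B' : set 'rV[R]_q) :
  A `<=` A' -> B `<=` B' -> A' `&` B' = set0 -> A `&` B = set0.
Proof.
move=> AA' BB' dis; apply/seteqP; split=> // x [/AA' A'x /BB' B'x].
by rewrite -dis.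
Qed.

(** All words of length [k] in two maps of equal ratio. *)
Lemma equal_ratio_copies (h : bool -> 'rV[R]_q -> 'rV[R]_q) c z k :
  (forall b, similitude (h b) c) -> (forall b, h b @` O `<=` O) ->
  h true @` O `&` h false @` O = set0 -> (forall b, h b z = z) ->
  exists (J : finType) (H : J -> 'rV[R]_q -> 'rV[R]_q),
    [/\ #|J| = (2 ^ k)%N, forall j, similitude (H j) (c ^+ k),
        forall j, H j @` O `<=` O, forall j, H j z = z &
        forall i j, i != j -> H i @` O `&` H j @` O = set0].
Proof.
move=> sim hO dis hz; elim: k => [|k [J [H [cardJ simH HO Hz disH]]]].
  exists unit, (fun=> id); split=> //.
  - by rewrite card_unit.
  - by move=> j; rewrite expr0; exact: similitude_id.
  - by move=> j _ [x Ox <-].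
have dis2 b b' : b != b' -> h b @` O `&` h b' @` O = set0.
  by case: b b' => [] [] // _; rewrite ?dis// setIC dis.
exists (prod bool J : finType), (fun bj => h bj.1 \o H bj.2); split.
- by rewrite card_prod card_bool cardJ expnS.
- by move=> [b j]; rewrite exprS; exact: similitude_comp.
- move=> [b j] _ [x Ox <-]; apply: (hO b); exists (H j x) => //.
  by apply: (HO j); exists x.
- by move=> [b j]; rewrite /= Hz hz.
move=> [b i] [b' j] bij; have [bb'|bb'] := eqVneq b b'.
  have ij : i != j by apply: contra_neq bij => ->; rewrite bb'.
  by rewrite /= -bb'; apply: image_comp_disjoint (sim b) (disH i j ij).
apply: subset_disjoint (dis2 b b' bb') => _ [x Ox <-] /=.
  by exists (H i x) => //; apply: (HO i); exists x.
by exists (H j x) => //; apply: (HO j); exists x.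
Qed.

(** With [h0 = g0 g1] and [h1 = g1 g0], which have the same ratio, there would be
    [2 ^ k] disjoint copies of [O] of one size at distances from the fixed
    point comparable to that size. *)
Lemma no_common_fixpoint (g0 g1 : 'rV[R]_q -> 'rV[R]_q) c0 c1 z :
  similitude g0 c0 -> similitude g1 c1 -> g0 @` O `<=` O -> g1 @` O `<=` O ->
  g0 @` O `&` g1 @` O = set0 -> g0 z = z -> g1 z = z -> False.
Proof.
move=> s0 s1 g0O g1O dis g0z g1z.
pose h b := if b then g0 \o g1 else g1 \o g0.
have sim b : similitude (h b) (c0 * c1).
  by case: b; [exact: similitude_comp|rewrite mulrC; exact: similitude_comp].
have hO1 : h true @` O `<=` g0 @` O.
  by move=> _ [x Ox <-]; exists (g1 x) => //; apply: g1O; exists x.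
have hO0 : h false @` O `<=` g1 @` O.
  by move=> _ [x Ox <-]; exists (g0 x) => //; apply: g0O; exists x.
have hO b : h b @` O `<=` O.
  by case: b; [exact: subset_trans hO1 g0O|exact: subset_trans hO0 g1O].
have hdis : h true @` O `&` h false @` O = set0 by exact: subset_disjoint dis.
have hz b : h b z = z by case: b; rewrite /= ?g1z ?g0z ?g1z.
have [x0 Ox0] := O0; have [om om0 ball_om] := openP_l2 oO Ox0.
have A0 : 0 < l2dist x0 z + 1 by rewrite ltr_wpDl// l2dist_ge0.
have [K packK] := packing q A0 om0.
have [J [H [cardJ simH _ Hz disH]]] := equal_ratio_copies K sim hO hdis hz.
have : (2 ^ K <= K)%N; last by rewrite leqNgt ltn_expl.
rewrite -cardJ -cardsT.
apply: (packK J _ (fun j => H j x0) z ((c0 * c1) ^+ K)).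
- by case: (sim true) => c0_gt0 _; rewrite exprn_gt0.
- move=> j _; rewrite -[X in l2dist _ X](Hz j); have [_ ->] := simH j.
  have ck : 0 < (c0 * c1) ^+ K by have [? _] := sim true; rewrite exprn_gt0.
  by rewrite mulrC ler_pM2r// lerDl.
- move=> i j _ _ ij.
  exact: similitude_separated om0 ball_om (simH i) (simH j) (disH i j ij).
Qed.

End common_fixpoint.

Section cells.
Variables (R : realType) (q : nat).
Local Notation T := (borel_rV R q).
Implicit Types (P mu : probability T R) (O V : set 'rV[R]_q).

(** The cells are compositions of words in several systems of maps, of
    different lengths; an abstract index set makes gluing a disjoint sum. *)
Record cells := Cells {
  cell_idx : finType;
  cell_map : cell_idx -> 'rV[R]_q -> 'rV[R]_q;
  cell_ratio : cell_idx -> R;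
  cell_mass : cell_idx -> R }.

(** A finite piece of self-similar structure inside [mu]: disjoint scaled
    copies of [P], one for each cell.  The disjoint images of [O] bound the
    number of cells of a given size near a point; [V] records where they lie,
    so that packings can be glued along maps with disjoint images of the
    respective sets [V]. *)
Definition packed O V P mu (S : cells) :=
  [/\ forall j : cell_idx S, [/\ similitude (cell_map j) (cell_ratio j),
        cell_ratio j <= 1 & 0 <= cell_mass j],
      forall j : cell_idx S, cell_map j @` O `<=` V,
      forall j k : cell_idx S, j != k ->
        cell_map j @` O `&` cell_map k @` O = set0 &
      forall phi : 'rV[R]_q -> R, measurable_fun [set: T] (phi : T -> R) ->
        (forall x, 0 <= phi x) ->
        (\sum_(j : cell_idx S) (cell_mass j)%:E * \int[P]_x (phi (cell_map j x))%:E
         <= \int[mu]_x (phi x)%:E)%E].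

Definition unit_cells : cells :=
  @Cells unit (fun=> id) (fun=> 1) (fun=> 1).

Lemma packed_unit O P : packed O O P P unit_cells.
Proof.
split=> [j|j _ [x Ox <-]//|[] []//|phi mphi phi0].
  by split=> //; exact: similitude_id.
by rewrite (big_pred1 tt) ?mul1e//; case.
Qed.

Definition glue_cells n (w : 'I_n -> R) (h : 'I_n -> 'rV[R]_q -> 'rV[R]_q)
    (c : 'I_n -> R) (S : 'I_n -> cells) : cells :=
  @Cells {i : 'I_n & cell_idx (S i)}
    (fun j => h (tag j) \o cell_map (tagged j))
    (fun j => c (tag j) * cell_ratio (tagged j))
    (fun j => w (tag j) * cell_mass (tagged j)).

Lemma card_glue_cells n (w : 'I_n -> R) h c S :
  #|cell_idx (glue_cells w h c S)| = (\sum_i #|cell_idx (S i)|)%N.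
Proof.
rewrite -sum1_card.
under [RHS]eq_bigr do rewrite -sum1_card.
by rewrite sig_big_dep.
Qed.

Lemma packed_glue n (w : 'I_n -> R) h c (S : 'I_n -> cells) O
    (V : 'I_n -> set 'rV[R]_q) W (Q : 'I_n -> probability T R) P mu :
  dominates w h Q mu -> (forall i, 0 <= w i) ->
  (forall i, similitude (h i) (c i) /\ c i <= 1) ->
  (forall i, h i @` V i `<=` W) ->
  (forall i j, i != j -> h i @` V i `&` h j @` V j = set0) ->
  (forall i, packed O (V i) P (Q i) (S i)) ->
  packed O W P mu (glue_cells w h c S).
Proof.
move=> dom w0 sim hW dis packS.
have ch i : continuous (h i) by exact: (similitude_continuous (sim i).1).
split.
- move=> [i j] /=; have [simj _ _ _] := packS i; have [s1 r1 m0] := simj j.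
  have [s2 r2] := sim i; split.
  + exact: similitude_comp.
  + by rewrite -[leRHS]mulr1 ler_pM//; [case: s2 => /ltW|case: s1 => /ltW].
  + by rewrite mulr_ge0.
- move=> [i j] _ [x Ox <-] /=; apply: (hW i); exists (cell_map j x) => //.
  by have [_ h1 _ _] := packS i; apply: (h1 j); exists x.
- move=> [i j] [i' k] /=; have [ii'|ii'] := eqVneq i i'.
    move: k; rewrite -ii' => k jk.
    have [_ _ disi _] := packS i; apply: image_comp_disjoint (sim i).1 _.
    by apply: disi; apply: contra_neq jk => ->.
  move=> _; apply: subset_disjoint (dis i i' ii') => _ [x Ox <-] /=.
    exists (cell_map j x) => //.
    by have [_ h1 _ _] := packS i; apply: (h1 j); exists x.
  exists (cell_map k x) => //.
  by have [_ h1 _ _] := packS i'; apply: (h1 k); exists x.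
- move=> phi mphi phi0; apply: le_trans (dom phi mphi phi0).
  have -> : (\sum_(j : cell_idx (glue_cells w h c S))
      (cell_mass j)%:E * \int[P]_x (phi (cell_map j x))%:E =
    \sum_i \sum_(j : cell_idx (S i))
      (w i * cell_mass j)%:E * \int[P]_x (phi (h i (cell_map j x)))%:E)%E.
    by rewrite sig_big_dep.
  apply: lee_sum => i _.
  have [_ _ _ int_le] := packS i.
  have := int_le (phi \o h i) _ (fun x => phi0 (h i x)).
  move=> /(_ (measurableT_comp mphi (measurable_continuous_map (ch i)))) le.
  apply: le_trans (lee_wpmul2l _ le); last by rewrite lee_fin.
  rewrite ge0_sume_distrr; last first.
    move=> j _; apply: mule_ge0; first by rewrite lee_fin; have [/(_ j)[]] := packS i.
    by apply: integral_ge0 => x _; rewrite lee_fin; exact: phi0.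
  by apply: lee_sum => j _; rewrite EFinM -muleA.
Qed.

End cells.

(** * Quantization errors bounded below by packings *)

Section finite_bounds.
Variables (R : realType) (n : nat) (v : 'I_n -> R).

Lemma finite_lower_bound : (forall i, 0 < v i) ->
  exists2 om : R, 0 < om <= 1 & forall i, om <= v i.
Proof.
move=> v0; exists (\big[Num.min/1]_i v i).
  by rewrite bigmin_le_id andbT; apply: lt_bigmin.
by move=> i; apply: bigmin_le_cond.
Qed.

Lemma finite_upper_bound : (forall i, v i < 1) ->
  exists2 la : R, 0 < la < 1 & forall i, v i <= la.
Proof.
move=> v1; exists (\big[Num.max/2^-1]_i v i).
  apply/andP; split; last by apply: bigmax_lt => //; rewrite invf_lt1// ltr1n.
  by apply: lt_le_trans (bigmax_ge_id _ _ _ _); rewrite invr_gt0.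
by move=> i; apply: le_bigmax_cond.
Qed.

End finite_bounds.

(** Induction on the order of magnitude of a budget [x] that is shared among
    the maps of an iterated function system in the proportions [v i]. *)
Lemma budget_ind (R : realType) n (v : 'I_n -> R) (om : R) (A : R -> Prop) :
  (forall i, v i < 1) -> (forall i, om <= v i) -> 0 < om ->
  (forall x, om <= x <= 1 -> A x) ->
  (forall x, 1 < x -> (forall i, A (x * v i)) -> A x) ->
  forall x, om <= x -> A x.
Proof.
move=> v1 omv om0 base step x omx.
have [la /andP[la0 la1] vla] := finite_upper_bound v1.
have x0 : 0 < x by exact: lt_le_trans omx.
have [k] : exists k, la ^+ k < x^-1.
  by apply: exprn_lt_exists; rewrite ?la0// invr_gt0.
rewrite -(ltr_pM2l x0) divff ?gt_eqF// => /ltW.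
elim: k x omx {x0} => [|k IH] x omx; first by rewrite mulr1 => x1; apply/base/andP.
have [x1 _|x1 xk] := leP x 1; first by apply/base/andP.
have x0 : 0 < x by exact: lt_trans x1.
apply: step => // i; have vi0 : 0 < v i by exact: lt_le_trans (omv i).
apply: IH; first by rewrite (le_trans (omv i))// ler_peMl// ltW.
apply: le_trans xk; rewrite exprS mulrA ler_pM2r ?exprn_gt0//.
by rewrite ler_pM2l.
Qed.

Section lower_bound.
Variables (R : realType) (q : nat).
Local Notation T := (borel_rV R q).
Implicit Types (P mu : probability T R) (O V : set 'rV[R]_q).

Lemma card_le_points (a : set 'rV[R]_q) n : a !=set0 -> (a #<= `I_n)%card ->
  exists pts : 'I_n -> 'rV[R]_q, forall y, a y -> exists i, pts i = y.
Proof.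
move=> /set0P/eqP a0 /pfcard_geP[//|[f]].
exists (fun i => f (nat_of_ord i)) => y ay.
have [k kn <-] := 'surj_f ay.
by exists (Ordinal kn).
Qed.

(** A cell that is not crowded sees all points at relative distance [eta] on
    the part of its copy of [P] that lies away from one point. *)
Lemma uncrowded_integral P rad eta del n (pts : 'I_n -> 'rV[R]_q)
    (a : set 'rV[R]_q) h rho r :
  0 < r -> spread P rad eta del -> a !=set0 ->
  (forall y, a y -> exists i, pts i = y) ->
  similitude h rho -> ~ crowded (rad + eta) eta pts h rho ->
  ((del * eta `^ r * rho `^ r)%:E <=
    \int[P]_x (l2dist_set (h x) a `^ r)%:E)%E.
Proof.
move=> r0 [rad0 eta0 del0 spreadP] a0 ptsP sim unc.
have [rho0 hrho] := sim.
have [z zP] : exists z, forall y, l2dist 0 y < rad -> 2 * eta < l2dist z y ->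
    eta * rho <= l2dist_set (h y) a.
  have far i y : l2dist 0 y < rad -> (rad + eta) * rho < l2dist (pts i) (h 0) ->
      eta * rho <= l2dist (h y) (pts i).
    move=> yrad; have := l2dist_triangle (h y) (h 0) (pts i).
    rewrite (l2distC (h 0)) hrho => h1 h2.
    have : rho * l2dist 0 y <= rho * rad by rewrite ler_pM2l// ltW.
    lra.
  have [[i near_i]|/forallNP none] :=
      pselect (exists i, l2dist (pts i) (h 0) <= (rad + eta) * rho).
    have [z hz] := similitude_surj sim (pts i); exists z => y yrad zy.
    apply: l2dist_set_ge => // _ /ptsP[k <-].
    have [near_k|] := leP (l2dist (pts k) (h 0)) ((rad + eta) * rho); last exact: far.
    have ik : l2dist (pts i) (pts k) < eta * rho.
      by rewrite ltNge; apply/negP => ik; apply: unc; exists i, k.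
    have := l2dist_triangle (pts k) (h y) (h z); rewrite hz (l2distC (pts k)).
    rewrite -{1}hz hrho (l2distC y).
    have : rho * (2 * eta) < rho * l2dist z y by rewrite ltr_pM2l.
    lra.
  exists 0 => y yrad _; apply: l2dist_set_ge => // _ /ptsP[k <-].
  by apply: far => //; rewrite ltNge; apply/negP/none.
set G : set T := [set y | l2dist 0 y < rad /\ 2 * eta < l2dist z y].
have mG : measurable G by exact: measurable_spread_set.
have mphi : measurable_fun [set: T] (fun x : T => (l2dist_set (h x) a `^ r)%:E).
  apply/measurable_EFinP.
  apply: (measurableT_comp (measurable_l2dist_set r a0)
     (measurable_continuous_map (similitude_continuous sim))).
apply: (@le_trans _ _ (\int[P]_(x in G) (l2dist_set (h x) a `^ r)%:E)%E); last first.
  by apply: ge0_subset_integral => // x _; rewrite lee_fin powR_ge0.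
apply: (@le_trans _ _ (\int[P]_(x in G) (cst ((eta * rho) `^ r)%:E) x)%E); last first.
  apply: ge0_le_integral => //.
  - by move=> x _; rewrite lee_fin powR_ge0.
  - exact: measurable_funTS.
  - move=> x [x1 x2]; rewrite lee_fin; apply: ge0_ler_powR.
    + exact: ltW.
    + by rewrite nnegrE mulr_ge0 ?ltW.
    + by rewrite nnegrE l2dist_set_ge0.
    + exact: zP.
rewrite integral_cst//.
have -> : del * eta `^ r * rho `^ r = (eta * rho) `^ r * del.
  by rewrite powRM ?ltW//; ring.
by rewrite EFinM; apply: lee_wpmul2l; [rewrite lee_fin powR_ge0|exact: spreadP].
Qed.

(** Only boundedly many cells per point are crowded, so a large packing has
    many cells that contribute their full share to the error. *)
Lemma packed_error O P rad eta del r : open O -> O !=set0 -> 0 < r ->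
  spread P rad eta del -> exists (C : nat) (ka : R), 0 < ka /\
  forall mu V S b n (a : set 'rV[R]_q), packed O V P mu S -> 0 <= b ->
    (forall j : cell_idx S, b <= cell_mass j * cell_ratio j `^ r) ->
    a !=set0 -> (a #<= `I_n)%card ->
    (((#|cell_idx S|%:R - (n * C)%:R) * ka * b)%:E <=
      \int[mu]_x (l2dist_set x a `^ r)%:E)%E.
Proof.
move=> oO O0 r0 spP; have [rad0 eta0 del0 _] := spP.
have D0 : 0 < rad + eta by rewrite addr_gt0.
have [C CP] := card_crowded oO O0 D0 eta0.
exists C, (del * eta `^ r); split; first by rewrite mulr_gt0 ?powR_gt0.
move=> mu V S b n a [simS _ disS intS] b0 massS a0 /(card_le_points a0)[pts ptsP].
set ka := del * eta `^ r.
have ka0 : 0 < ka by rewrite mulr_gt0 ?powR_gt0.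
pose bad := [set j : cell_idx S |
  `[< crowded (rad + eta) eta pts (cell_map j) (cell_ratio j) >]]%SET.
have cardbad : (#|bad| <= n * C)%N.
  by apply: CP => // j; have [] := simS j.
apply: le_trans (intS _ (measurable_l2dist_set r a0) _); last first.
  by move=> x; exact: powR_ge0.
apply: (@le_trans _ _ (\sum_(j in ~: bad) (ka * b)%:E)%E).
  rewrite sumEFin lee_fin sumr_const -[leRHS]mulr_natl -mulrA ler_wpM2r//.
    by rewrite mulr_ge0// ltW.
  by rewrite lerBlDr -natrD ler_nat -(cardsC bad) addnC leq_add2l.
rewrite [leRHS](bigID (fun j => j \in ~: bad))/=.
rewrite -[leLHS]adde0; apply: leeD; last first.
  apply: sume_ge0 => j _; apply: mule_ge0; first by rewrite lee_fin; have [] := simS j.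
  by apply: integral_ge0 => x _; rewrite lee_fin powR_ge0.
apply: lee_sum => j; rewrite !inE => /asboolPn unc.
have [simj _ m0] := simS j.
apply: (@le_trans _ _ ((cell_mass j)%:E * (ka * cell_ratio j `^ r)%:E)%E).
  by rewrite -EFinM lee_fin mulrCA ler_pM2l.
apply: lee_wpmul2l; first by rewrite lee_fin.
exact: (uncrowded_integral r0 spP a0 ptsP simj unc).
Qed.

(** A map of proportion [v i] multiplies the mass times the [r]-th power of the
    ratio by [v i `^ e], and this is compensated by the smaller budget
    [x * v i] of its cells. *)
Lemma packed_growth n (t c v : 'I_n -> R) (g : 'I_n -> 'rV[R]_q -> 'rV[R]_q)
    O P r e :
  dominates t g (fun=> P) P -> (forall i, 0 < t i) ->
  (forall i, similitude (g i) (c i) /\ c i <= 1) ->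
  (forall i, g i @` O `<=` O) ->
  (forall i j, i != j -> g i @` O `&` g j @` O = set0) ->
  0 < e -> (forall i, 0 < v i < 1) -> \sum_i v i = 1 ->
  (forall i, t i * c i `^ r = v i `^ e) ->
  exists2 om : R, 0 < om & forall x, om <= x -> exists S : cells R q,
    [/\ packed O O P P S, x <= #|cell_idx S|%:R &
      forall j : cell_idx S, (om / x) `^ e <= cell_mass j * cell_ratio j `^ r].
Proof.
move=> domP t0 sim gO dis e0 v01 v1 tcv.
have v0 i : 0 < v i by have /andP[] := v01 i.
have [om /andP[om0 om1] omv] := finite_lower_bound v0.
exists om => //; apply: (budget_ind (v := v)) => //.
- by move=> i; have /andP[] := v01 i.
- move=> x /andP[omx x1]; exists (unit_cells R q); split.
  + exact: packed_unit.
  + by rewrite card_unit.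
  + move=> j; rewrite /= mul1r powR1.
    have x0 := lt_le_trans om0 omx.
    apply: (@le_trans _ _ (1 `^ e)); last by rewrite powR1.
    apply: ge0_ler_powR; rewrite ?nnegrE ?(ltW e0)//.
      by rewrite divr_ge0// ltW.
    by rewrite ler_pdivrMr// mul1r.
- move=> x x1 /choice[S SP]; have x0 : 0 < x by exact: lt_trans x1.
  exists (glue_cells t g c S); split.
  + apply: (packed_glue (V := fun=> O)) domP _ sim gO dis _.
      by move=> i; exact: ltW.
    by move=> i; have [packS _ _] := SP i.
  + rewrite card_glue_cells natr_sum.
    apply: (@le_trans _ _ (\sum_i x * v i)).
      by rewrite -mulr_sumr v1 mulr1.
    by apply: ler_sum => i _; have [_ cardS _] := SP i.
  + move=> [i j] /=; have [_ _ /(_ j) h] := SP i.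
    have [[ci0 _] _] := sim i; have [[/(_ j)[[rj0 _] _ _] _ _ _] _ _] := SP i.
    have -> : t i * cell_mass j * (c i * cell_ratio j) `^ r =
        v i `^ e * (cell_mass j * cell_ratio j `^ r).
      by rewrite powRM ?ltW// -tcv; ring.
    apply: (@le_trans _ _ (v i `^ e * (om / (x * v i)) `^ e)).
      rewrite -powRM ?divr_ge0 ?mulr_ge0 ?(ltW x0) ?(ltW om0) ?(ltW (v0 i))//.
      have -> // : v i * (om / (x * v i)) = om / x.
      by have := v0 i; have := x0; move=> ? ?; field; rewrite !gt_eqF.
    by rewrite ler_pM2l// powR_gt0.
Qed.

End lower_bound.

(** * Interleaving the levels of a condensation system *)

Section heads.

Definition with_head (A : Type) n (a : A) (F : 'I_n -> A) (i : 'I_n.+1) : A :=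
  if unlift ord0 i is Some j then F j else a.

Lemma with_head0 A n (a : A) (F : 'I_n -> A) : with_head a F ord0 = a.
Proof. by rewrite /with_head unlift_none. Qed.

Lemma with_headS A n (a : A) (F : 'I_n -> A) j :
  with_head a F (lift ord0 j) = F j.
Proof. by rewrite /with_head liftK. Qed.

Lemma forall_head n (A : 'I_n.+1 -> Prop) :
  A ord0 -> (forall j, A (lift ord0 j)) -> forall i, A i.
Proof. by move=> A0 AS i; case: (unliftP ord0 i) => [j ->|->]. Qed.

Lemma mixture_with_head (R : realType) (q N : nat)
    (f : 'I_N -> 'rV[R]_q -> 'rV[R]_q) (p : 'I_N.+1 -> R)
    (nu mu : probability (borel_rV R q) R) :
  inhomogeneous_self_similar_measure f p nu mu ->
  mixture p (with_head id f) (with_head nu (fun=> mu)) mu.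
Proof.
move=> hmu A mA; rewrite hmu// [RHS]big_ord_recl !with_head0.
by congr (_ + _)%E; apply: eq_bigr => j _; rewrite !with_headS.
Qed.

End heads.

Section interleaved_growth.
Variables (R : realType) (q : nat).
Implicit Types (O V U : set 'rV[R]_q).

Lemma packed_void O V (P mu : probability (borel_rV R q) R) :
  packed O V P mu (@Cells R q void (fun=> id) (fun=> 1) (fun=> 1)).
Proof.
split=> [[]|[]|[]|phi mphi phi0]; rewrite big_pred0; last by case.
by apply: integral_ge0 => x _; rewrite lee_fin.
Qed.

(** Each level of the condensation system contributes its own [x] cells, on
    images of [O]; as the proportions [v i] again sum to [1], all levels have
    the same weight and [k] of them yield [k * x] cells. *)
Lemma interleaved_growth N (f : 'I_N -> 'rV[R]_q -> 'rV[R]_q) p s v nu mu O U r e om :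
  inhomogeneous_self_similar_measure f p nu mu -> (forall i, 0 < p i) ->
  (forall i, similitude (f i) (s i) /\ s i <= 1) ->
  (forall i, f i @` U `<=` U) -> O `<=` U ->
  (forall i j, i != j -> f i @` U `&` f j @` U = set0) ->
  (forall i, O `&` f i @` U = set0) ->
  0 < e -> (forall i, 0 < v i < 1) -> \sum_i v i = 1 ->
  (forall i, p (lift ord0 i) * s i `^ r = v i `^ e) ->
  0 < om -> (forall x, om <= x -> exists S : cells R q,
    [/\ packed O O nu nu S, x <= #|cell_idx S|%:R &
      forall j : cell_idx S, (om / x) `^ e <= cell_mass j * cell_ratio j `^ r]) ->
  forall k, exists2 X : R, 0 < X & forall x, X <= x -> exists S : cells R q,
    [/\ packed O U nu mu S, k%:R * x <= #|cell_idx S|%:R &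
      forall j : cell_idx S,
        p ord0 * (om / x) `^ e <= cell_mass j * cell_ratio j `^ r].
Proof.
move=> /mixture_with_head mixmu p0 sim fU OU disf disO e0 v01 v1 psv om0 grow.
have simh i : similitude (with_head id f i) (with_head 1 s i) /\ with_head 1 s i <= 1.
  move: i; apply: forall_head => [|j]; rewrite ?with_head0 ?with_headS //.
  by split=> //; exact: similitude_id.
have dommu : dominates p (with_head id f) (with_head nu (fun=> mu)) mu.
  apply: mixture_dominates => // i; first exact: ltW.
  exact: similitude_continuous (simh i).1.
have v0 i : 0 < v i by have /andP[] := v01 i.
have [vm /andP[vm0 _] vmv] := finite_lower_bound v0.
elim=> [|k [X X0 IH]].
  exists 1 => // x _; exists (@Cells R q void (fun=> id) (fun=> 1) (fun=> 1)).
  by split=> [|//|[]]; [exact: packed_void|rewrite mul0r].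
exists (Num.max om (X / vm)); first by rewrite lt_max om0.
move=> x; rewrite ge_max ler_pdivrMr// => /andP[omx Xx].
have x0 : 0 < x by exact: lt_le_trans omx.
have [S0 [pack0 card0 mass0]] := grow x omx.
have /choice[S SP] i := IH (x * v i) (le_trans Xx (ler_wpM2l (ltW x0) (vmv i))).
exists (glue_cells p (with_head id f) (with_head 1 s) (with_head S0 S)); split.
- apply: (@packed_glue _ _ _ _ _ _ _ _ (with_head O (fun=> U)) _
      (with_head nu (fun=> mu))) => //.
  + by move=> i; exact: ltW.
  + apply: forall_head => [|j]; rewrite ?with_head0 ?with_headS //.
    by move=> _ [x' Ox' <-]; exact: OU.
  + apply: forall_head => [|i]; apply: forall_head => [|j];
      rewrite ?with_head0 ?with_headS ?image_id ?eqxx// => ij.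
      by rewrite setIC.
    by apply: disf; apply: contra_neq ij => ->.
  + apply: forall_head => [|j]; rewrite ?with_head0 ?with_headS //.
    by have [packS _ _] := SP j.
- rewrite card_glue_cells natr_sum big_ord_recl with_head0.
  rewrite -natr1 mulrDl mul1r addrC; apply: lerD => //.
  apply: (@le_trans _ _ (\sum_i k%:R * (x * v i))).
    by rewrite -!mulr_sumr v1 mulr1.
  apply: ler_sum => i _; rewrite with_headS.
  by have [_ cardS _] := SP i.
- move=> [i j]; move: i j; apply: forall_head => [|i];
    rewrite /= ?with_head0 ?with_headS => j.
    by rewrite mul1r -mulrA ler_pM2l// mass0.
  have [[/(_ j)[[rj0 _] _ _] _ _ _] _ /(_ j) h] := SP i.
  have [[si0 _] _] := sim i.
  have -> : p (lift ord0 i) * cell_mass j * (s i * cell_ratio j) `^ r =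
        v i `^ e * (cell_mass j * cell_ratio j `^ r).
    by rewrite powRM ?ltW// -psv; ring.
  apply: (@le_trans _ _ (v i `^ e * (p ord0 * (om / (x * v i)) `^ e))).
    rewrite mulrCA -powRM ?divr_ge0 ?mulr_ge0 ?(ltW x0) ?(ltW om0) ?(ltW (v0 i))//.
    have -> // : v i * (om / (x * v i)) = om / x.
    by have := v0 i; have := x0; move=> ? ?; field; rewrite !gt_eqF.
  by rewrite ler_pM2l// powR_gt0.
Qed.

End interleaved_growth.

(** * Covers and upper bounds *)

Section covers.
Variables (R : realType) (q : nat).
Local Notation T := (borel_rV R q).
Implicit Types (P nu mu : probability T R).

(** The integral is bounded rather than its infimum over all sets of [k]
    points, since the bounds for the components are transported by mapping
    the sets; real values of [k] make the division of a budget exact. *)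
Definition covered P (r k d : R) := exists s : seq 'rV[R]_q,
  [/\ s != [::], (size s)%:R <= k &
    (\int[P]_x (l2dist_set x [set` s] `^ r)%:E <= d%:E)%E].

Lemma covered_le P r k k' d d' : k <= k' -> d <= d' ->
  covered P r k d -> covered P r k' d'.
Proof.
move=> kk' dd' [s [s0 sk sd]]; exists s; split=> //; first exact: le_trans kk'.
by apply: le_trans sd _; rewrite lee_fin.
Qed.

Lemma covered_point P r : 0 < r -> bounded_measure P ->
  exists2 D : R, 0 <= D & covered P r 1 D.
Proof.
move=> r0 /(bounded_moment r0)[D D0 PD]; exists D; first exact: D0.
exists [:: 0]; split=> [//|//|]; apply: le_trans PD.
rewrite le_eqVlt; apply/orP; left; apply/eqP.
apply: eq_integral => x _; congr ((l2dist_set x _ `^ r)%:E).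
by apply/seteqP; split=> y /=; rewrite inE => /eqP.
Qed.

(** Covers of the components are transported by the similitudes. *)
Lemma mixture_covered n (w c k d : 'I_n -> R) h (Q : 'I_n -> probability T R) P r :
  (0 < n)%N -> 0 < r ->
  mixture w h Q P -> (forall i, 0 <= w i) -> (forall i, similitude (h i) (c i)) ->
  (forall i, covered (Q i) r (k i) (d i)) ->
  covered P r (\sum_i k i) (\sum_i w i * c i `^ r * d i).
Proof.
move=> n0 r0 mixP w0 sim /choice[s sP].
pose S := flatten [seq map (h i) (s i) | i <- enum 'I_n].
have inS i y : y \in s i -> h i y \in S.
  move=> ys; apply/flattenP; exists (map (h i) (s i)); last exact: map_f.
  by apply: map_f; rewrite mem_enum.
have s0 i : [set` s i] !=set0.
  have [+ _ _] := sP i; case: (s i) => // y l _.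
  by exists y; rewrite /= mem_head.
have S0 : [set` S] !=set0.
  by have [y ys] := s0 (Ordinal n0); exists (h (Ordinal n0) y); exact: inS.
exists S; split.
- by have [y yS] := S0; apply/eqP => Snil; move: yS; rewrite /= Snil.
- rewrite size_flatten /shape -map_comp sumnE big_map big_enum/= natr_sum.
  by apply: ler_sum => i _; rewrite size_map; have [_ sk _] := sP i.
have ch i : continuous (h i) by exact: (similitude_continuous (sim i)).
rewrite (integral_mixture w0 ch mixP (measurable_l2dist_set r S0)); last first.
  by move=> x; exact: powR_ge0.
rewrite -sumEFin; apply: lee_sum => i _.
rewrite -mulrA EFinM; apply: lee_wpmul2l; first by rewrite lee_fin.
have [ci0 _] := sim i; have [_ _ sd] := sP i.
rewrite EFinM; apply: le_trans (lee_wpmul2l _ sd); last by rewrite lee_fin powR_ge0.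
have ms : measurable_fun [set: T]
    (fun x : T => (l2dist_set x [set` s i] `^ r)%:E).
  by apply/measurable_EFinP; exact: measurable_l2dist_set.
rewrite -ge0_integralZl_EFin ?powR_ge0//; last first.
  by move=> x _; rewrite lee_fin powR_ge0.
apply: ge0_le_integral.
- exact: measurableT.
- by move=> x _; rewrite lee_fin powR_ge0.
- apply/measurable_EFinP.
  exact: (measurableT_comp (measurable_l2dist_set r S0)
    (measurable_continuous_map (ch i))).
- exact: measurable_funeM.
move=> x _; rewrite -EFinM lee_fin -powRM ?l2dist_set_ge0 ?(ltW ci0)//.
apply: ge0_ler_powR; rewrite ?nnegrE ?(ltW r0) ?mulr_ge0 ?l2dist_set_ge0 ?(ltW ci0)//.
rewrite -(l2dist_set_image x (s0 i) (sim i)); apply: le_l2dist_set.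
  by have [y ys] := s0 i; exists (h i y), y.
by move=> _ [y ys <-]; exact: inS.
Qed.

Lemma powR_split (v x e D : R) : 0 < v -> 0 < x ->
  v `^ e * (D * (x * v) `^ (1 - e)) = D * x `^ (1 - e) * v.
Proof.
move=> v0 x0; rewrite powRM ?(ltW x0) ?(ltW v0)//.
rewrite !powRB ?(gt_eqF x0) ?(gt_eqF v0) ?implybT// !powRr1 ?(ltW x0) ?(ltW v0)//.
by field; rewrite !gt_eqF// powR_gt0.
Qed.

Lemma powR_le1_ge1 (x e : R) : 0 < x <= 1 -> 1 <= e -> 1 <= x `^ (1 - e).
Proof.
move=> /andP[x0 x1] e1; rewrite -[leLHS](powRr0 x).
apply: ger_powR; first by rewrite x0.
by rewrite subr_le0.
Qed.

(** A map that gets the share [x * v i] of the budget contributes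
    [D * x `^ (1 - e) * v i], so that the bound reproduces itself. *)
Lemma self_similar_covered n (t c v : 'I_n -> R) g P r e :
  (0 < n)%N -> 0 < r -> mixture t g (fun=> P) P -> (forall i, 0 <= t i) ->
  (forall i, similitude (g i) (c i)) -> bounded_measure P ->
  1 <= e -> (forall i, 0 < v i < 1) -> \sum_i v i <= 1 ->
  (forall i, t i * c i `^ r = v i `^ e) ->
  exists om K D : R, [/\ 0 < om <= 1, 0 < K, 0 <= D &
    forall x, om <= x -> covered P r (K * x) (D * x `^ (1 - e))].
Proof.
move=> n0 r0 mixP t0 sim bP e1 v01 v1 tcv.
have v0 i : 0 < v i by have /andP[] := v01 i.
have [om /andP[om0 om1] omv] := finite_lower_bound v0.
have [D D0 coverD] := covered_point r0 bP.
exists om, om^-1, D; split=> //; [by rewrite om0|by rewrite invr_gt0|].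
apply: (budget_ind (v := v)) => //.
- by move=> i; have /andP[] := v01 i.
- move=> x /andP[omx x1]; have x0 := lt_le_trans om0 omx.
  apply: covered_le coverD; first by rewrite ler_pdivlMl// mulr1.
  by rewrite ler_peMr// powR_le1_ge1// x0.
move=> x x1 IH; have x0 : 0 < x by exact: lt_trans x1.
apply: covered_le (mixture_covered n0 r0 mixP t0 sim IH).
  rewrite -mulr_sumr -mulr_sumr ler_pM2l ?invr_gt0//.
  by rewrite ger_pMr.
under eq_bigr do rewrite tcv powR_split//.
by rewrite -mulr_sumr ler_piMr// mulr_ge0// powR_ge0.
Qed.

(** The budget is shared among the [f i] as before; since the proportions leave
    out the fraction [1 - th], a whole further budget for [nu] is absorbed by
    enlarging the constants by a factor [1 / (1 - th)]. *)
Lemma inhomogeneous_covered N (f : 'I_N -> 'rV[R]_q -> 'rV[R]_q) p s v nu mu r e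
    om0 K0 D0 :
  0 < r -> inhomogeneous_self_similar_measure f p nu mu ->
  probability_vector p -> (forall i, similitude (f i) (s i)) ->
  bounded_measure mu ->
  1 <= e -> (forall i, 0 < v i < 1) -> \sum_i v i < 1 ->
  (forall i, p (lift ord0 i) * s i `^ r = v i `^ e) ->
  om0 <= 1 -> 0 <= K0 -> 0 <= D0 ->
  (forall x, om0 <= x -> covered nu r (K0 * x) (D0 * x `^ (1 - e))) ->
  exists om K D : R, [/\ 0 < om <= 1, 0 < K, 0 <= D &
    forall x, om <= x -> covered mu r (K * x) (D * x `^ (1 - e))].
Proof.
move=> r0 /mixture_with_head mixmu [p0 p1] sim bmu e1 v01 v1 psv om01 K00 D00 cnu.
have v0 i : 0 < v i by have /andP[] := v01 i.
have [om /andP[om_gt0 om1] omv] := finite_lower_bound v0.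
have [D1 D10 coverD] := covered_point r0 bmu.
set th := \sum_i v i in v1.
have th0 : 0 < 1 - th by rewrite subr_gt0.
have pz1 : p ord0 <= 1.
  by rewrite -p1 (bigD1 ord0)//= lerDl sumr_ge0.
pose K := K0 / (1 - th) + om^-1; pose D := D0 / (1 - th) + D1.
have Kom : om^-1 <= K by rewrite lerDr divr_ge0 ?(ltW th0).
have DD1 : D1 <= D by rewrite lerDr divr_ge0 ?(ltW th0).
have K_gt0 : 0 < K by apply: lt_le_trans Kom; rewrite invr_gt0.
have D_ge0 : 0 <= D by exact: le_trans DD1.
have KK0 : K0 + K * th <= K.
  rewrite -lerBrDr -{1}[K]mulr1 -mulrBr /K mulrDl divfK ?gt_eqF//.
  by rewrite lerDl mulr_ge0 ?invr_ge0 ?ltW.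
have DD0 : D0 + D * th <= D.
  rewrite -lerBrDr -{1}[D]mulr1 -mulrBr /D mulrDl divfK ?gt_eqF//.
  by rewrite lerDl mulr_ge0// ltW.
exists om, K, D; split=> //; first by rewrite om_gt0.
apply: (budget_ind (v := v)) => //.
- by move=> i; have /andP[] := v01 i.
- move=> x /andP[omx x1]; have x0 := lt_le_trans om_gt0 omx.
  apply: covered_le coverD.
    by apply: le_trans (ler_wpM2r (ltW x0) Kom); rewrite ler_pdivlMl// mulr1.
  by apply: le_trans DD1 _; rewrite ler_peMr// powR_le1_ge1// x0.
move=> x x1 IH; have x0 : 0 < x by exact: lt_trans x1.
pose k := with_head (K0 * x) (fun i => K * (x * v i)).
pose d := with_head (D0 * x `^ (1 - e)) (fun i => D * (x * v i) `^ (1 - e)).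
pose c := with_head 1 s.
have simh i : similitude (with_head id f i) (c i).
  move: i; apply: forall_head => [|j]; rewrite /c ?with_head0 ?with_headS//.
  exact: similitude_id.
have cov i : covered (with_head nu (fun=> mu) i) r (k i) (d i).
  move: i; apply: forall_head => [|j]; rewrite /k /d ?with_head0 ?with_headS//.
  by apply: cnu; rewrite (le_trans om01)// ltW.
apply: covered_le (mixture_covered (ltn0Sn N) r0 mixmu p0 simh cov).
  rewrite big_ord_recl /k with_head0.
  under eq_bigr do rewrite with_headS mulrA.
  by rewrite -mulr_sumr -/th mulrAC -mulrDl ler_pM2r.
rewrite big_ord_recl /c /d !with_head0 powR1 mulr1.
under eq_bigr do rewrite !with_headS psv powR_split//.
rewrite -mulr_sumr -/th mulrAC mulrA -mulrDl ler_wpM2r ?powR_ge0//.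
apply: le_trans DD0; rewrite lerD2r.
by rewrite ler_piMl.
Qed.

End covers.

(** * Geometry of self-similar and in-homogeneous measures *)

Section seeds.
Variables (R : realType) (q : nat).
Local Notation T := (borel_rV R q).
Implicit Types (C F O U : set 'rV[R]_q).

Lemma compact_closed_gap C F : compact C -> closed F -> C `&` F = set0 ->
  exists2 de : R, 0 < de & forall x y, C x -> F y -> de <= l2dist x y.
Proof.
move=> cC cF CF; have [C0|C0] := pselect (C !=set0); last first.
  by exists 1 => // x y Cx; case: C0; exists x.
have [F0|F0] := pselect (F !=set0); last first.
  by exists 1 => // x y _ Fy; case: F0; exists y.
have [x0 x0C x0min] : exists2 x, x \in C &
    forall y, y \in C -> l2dist_set x F <= l2dist_set y F.
  apply: compact_EVT_min => //; apply: continuous_subspaceT.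
  exact: l2dist_set_continuous.
have Cx0 : C x0 by exact: set_mem.
have oF : open (~` F) by exact: closed_openC.
have Fx0 : (~` F) x0 by move=> Fx0; rewrite -[False]/(set0 x0) -CF.
have [e e0 he] := openP_l2 oF Fx0.
exists e => // x y Cx Fy.
apply: le_trans (l2dist_set_le x Fy); apply: le_trans (x0min x (mem_set Cx)).
by apply: l2dist_set_ge => // z Fz; rewrite leNgt; apply/negP => /he.
Qed.

Lemma closed_similitude_image h c F : similitude h c -> closed F ->
  closed (h @` F).
Proof.
move=> sim cF; rewrite -openC openE => x xF; have [c0 hc] := sim.
have [y hy] := similitude_surj sim x.
have oF : open (~` F) by exact: closed_openC.
have Fy : (~` F) y by move=> Fy; apply: xF; exists y.
have [e e0 he] := openP_l2 oF Fy.
have ce0 : 0 < c * e by rewrite mulr_gt0.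
apply: (@filterS _ (nbhs x) _ _ _ _ (nbhs_l2ball x ce0)) => z /= xz [u Fu uz].
by apply: (he u) => //; rewrite -(ltr_pM2l c0) -hc hy uz.
Qed.

Definition halo C (de : R) : set 'rV[R]_q :=
  [set y | exists2 x, C x & l2dist x y < de].

Lemma open_halo C de : open (halo C de).
Proof.
rewrite openE => y [x Cx xy]; have e0 : 0 < de - l2dist x y by rewrite subr_gt0.
apply: (@filterS _ (nbhs y) _ _ _ _ (nbhs_l2ball y e0)) => z /= yz.
by exists x => //; have := l2dist_triangle y x z; lra.
Qed.

(** An open set for [g] can be shrunk to any neighbourhood of an invariant set
    [C]: a metric neighbourhood of [C] is itself invariant, and the orbits of
    [g] enter it. *)
Lemma seed_halo n (g : 'I_n -> 'rV[R]_q -> 'rV[R]_q) c C O de : (0 < n)%N ->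
  (forall i, contractive_similitude (g i) (c i)) ->
  open O -> O !=set0 -> (forall i, g i @` O `<=` O) ->
  C !=set0 -> (forall i x, C x -> C (g i x)) -> 0 < de ->
  [/\ open (O `&` halo C de), O `&` halo C de !=set0 &
      forall i, g i @` (O `&` halo C de) `<=` O `&` halo C de].
Proof.
move=> n0 sim oO [x0 Ox0] gO [z Cz] gC de0; split.
- by apply: openI => //; exact: open_halo.
- pose i := Ordinal n0; have [/andP[c0 c1] gc] := sim i.
  have d0 := l2dist_ge0 z x0.
  have [k ck] : exists k, c i ^+ k < de / (l2dist z x0 + 1).
    by apply: exprn_lt_exists; rewrite ?c0// divr_gt0// ltr_wpDl.
  have Ok : O (iter k (g i) x0).
    by elim: k {ck} => //= k IH; apply: (gO i); exists (iter k (g i) x0).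
  have Ck : C (iter k (g i) z) by elim: k {ck Ok} => //= k IH; exact: gC.
  have dk : l2dist (iter k (g i) z) (iter k (g i) x0) = c i ^+ k * l2dist z x0.
    elim: k {ck Ok Ck} => [|k IH]; first by rewrite mul1r.
    by rewrite /= gc IH exprS mulrA.
  exists (iter k (g i) x0); split=> //; exists (iter k (g i) z) => //.
  rewrite dk; apply: le_lt_trans (_ : c i ^+ k * (l2dist z x0 + 1) < _).
    by rewrite ler_wpM2l ?lerDl// exprn_ge0 ?ltW.
  by rewrite -ltr_pdivlMr// ltr_wpDl.
- move=> i _ [y [Oy [x Cx xy]] <-]; split; first by apply: (gO i); exists y.
  exists (g i x); first exact: gC.
  have [/andP[c0 c1] ->] := sim i; apply: le_lt_trans xy.
  by rewrite ler_piMl ?l2dist_ge0// ltW.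
Qed.

Lemma contractive_similitudeW (h : 'rV[R]_q -> 'rV[R]_q) c :
  contractive_similitude h c -> similitude h c /\ c <= 1.
Proof. by move=> [/andP[c0 c1] hc]; split; [split|exact: ltW]. Qed.

Lemma self_similar_bounded n (g : 'I_n -> 'rV[R]_q -> 'rV[R]_q) c t
    (nu : probability T R) :
  (forall i, contractive_similitude (g i) (c i)) -> probability_vector t ->
  self_similar_measure g t nu -> bounded_measure nu.
Proof.
move=> sim pt mixnu.
have [la la01 cla] : exists2 la : R, 0 < la < 1 & forall i, c i <= la.
  by apply: finite_upper_bound => i; have [/andP[]] := sim i.
apply: (@mixture_bounded _ _ n t g (fun=> nu) nu la) => //.
  move=> i; left; split=> // x; have [_ ->] := sim i.
  by rewrite ler_wpM2r// l2dist_ge0.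
by move=> i; apply: (similitude_continuous (contractive_similitudeW (sim i)).1).
Qed.

Lemma inhomogeneous_bounded N (f : 'I_N -> 'rV[R]_q -> 'rV[R]_q) s p
    (nu mu : probability T R) :
  (forall i, contractive_similitude (f i) (s i)) -> probability_vector p ->
  bounded_measure nu -> inhomogeneous_self_similar_measure f p nu mu ->
  bounded_measure mu.
Proof.
move=> sim pp [rad nurad] /mixture_with_head mixmu.
have [la la01 sla] : exists2 la : R, 0 < la < 1 & forall i, s i <= la.
  by apply: finite_upper_bound => i; have [/andP[]] := sim i.
apply: (mixture_bounded mixmu pp la01); apply: forall_head => [|j];
  rewrite ?with_head0 ?with_headS.
- by right; exists rad.
- left; split=> // x; have [_ ->] := sim j.
  by rewrite ler_wpM2r// l2dist_ge0.
- by move=> x; exact: cvg_id.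
- by apply: (similitude_continuous (contractive_similitudeW (sim j)).1).
Qed.

(** If the support of [nu] were a point, that point would be fixed by all
    [g i]. *)
Lemma self_similar_spread M (g : 'I_M -> 'rV[R]_q -> 'rV[R]_q) c t O
    (nu : probability T R) : (1 < M)%N ->
  (forall i, contractive_similitude (g i) (c i)) ->
  probability_vector t -> (forall i, 0 < t i) -> self_similar_measure g t nu ->
  open O -> O !=set0 -> (forall i, g i @` O `<=` O) ->
  (forall i j, i != j -> g i @` O `&` g j @` O = set0) ->
  exists rad eta del, spread nu rad eta del.
Proof.
move=> M1 sim pt t0 mixnu oO O0 gO dis.
have bnu := self_similar_bounded sim pt mixnu.
have simi i := (contractive_similitudeW (sim i)).1.
have suppg i x : msupport nu x -> msupport nu (g i x).
  apply: (@mixture_msupport _ _ _ t g (fun=> nu)) => //.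
    by move=> j; exact: ltW.
  exact: similitude_continuous (simi i).
have [z zsupp] := msupport_neq0 bnu.
have [[i gz]|/forallNP fixz] := pselect (exists i, g i z != z).
  exact: (spread_two_points (suppg i z zsupp) zsupp gz).
have {}fixz i : g i z = z by apply/eqP/negPn/negP; exact: fixz.
pose i0 : 'I_M := Ordinal (ltnW M1); pose i1 : 'I_M := Ordinal M1.
have := no_common_fixpoint oO O0 (simi i0) (simi i1) (gO i0) (gO i1)
  (dis i0 i1 isT) (fixz i0) (fixz i1).
by [].
Qed.

End seeds.

(** * Exponents and quantization errors *)

Section proportions.
Variable R : realType.
Implicit Types (a r s x : R).

(** For [a] the mass times the [r]-th power of the ratio of a map, this is the
    share of the points that the map receives in an optimal allocation at the
    dimension [s]; the shares sum to [1] at the critical dimension. *)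
Definition proportion r s a := a `^ (s / (s + r)).

Lemma proportion_powR r s a : 0 < r -> 0 < s -> 0 <= a ->
  a = proportion r s a `^ (1 + r / s).
Proof.
move=> r0 s0 a0; rewrite -powRrM.
have -> : s / (s + r) * (1 + r / s) = 1.
  by field; rewrite !gt_eqF// addr_gt0.
by rewrite powRr1.
Qed.

Lemma proportion_itv r s a : 0 < r -> 0 < s -> 0 < a < 1 ->
  0 < proportion r s a < 1.
Proof.
move=> r0 s0 /andP[a0 a1]; rewrite powR_gt0//=.
apply: lt_le_trans (_ : 1 `^ (s / (s + r)) <= _); last by rewrite powR1.
have u0 : 0 < s / (s + r) by rewrite divr_gt0// addr_gt0.
by apply: gt0_ltr_powR; rewrite ?nnegrE ?ltW.
Qed.

Lemma ltr_proportion r s s' a : 0 < r -> 0 < s -> s < s' -> 0 < a < 1 ->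
  proportion r s' a < proportion r s a.
Proof.
move=> r0 s0 ss' /andP[a0 a1]; have s'0 : 0 < s' by exact: lt_trans ss'.
pose d := s' / (s' + r) - s / (s + r).
have d0 : 0 < d.
  have -> : d = r * (s' - s) / ((s' + r) * (s + r)).
    by rewrite /d; field; rewrite !gt_eqF// addr_gt0.
  by rewrite divr_gt0 ?mulr_gt0 ?subr_gt0 ?addr_gt0.
have -> : proportion r s' a = proportion r s a * a `^ d.
  by rewrite /proportion -powRD ?(gt_eqF a0) ?implybT// /d [X in _ = _ `^ X]addrC subrK.
rewrite -[ltRHS]mulr1 ltr_pM2l ?powR_gt0//.
apply: lt_le_trans (_ : 1 `^ d <= _); last by rewrite powR1.
by apply: gt0_ltr_powR; rewrite ?nnegrE ?ltW.
Qed.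

Lemma ler_proportion r s s' a : 0 < r -> 0 < s -> s <= s' -> 0 < a < 1 ->
  proportion r s' a <= proportion r s a.
Proof.
move=> r0 s0; rewrite le_eqVlt => /orP[/eqP -> //|ss'] a01.
exact: ltW (ltr_proportion r0 s0 ss' a01).
Qed.

End proportions.

Section quantization_error.
Variables (R : realType) (q : nat).
Local Notation T := (borel_rV R q).
Variables (r : R) (P : probability T R).
Hypothesis r0 : 0 < r.

Lemma card_seq_le (s : seq 'rV[R]_q) n : (size s <= n)%N ->
  ([set` s] #<= `I_n)%card.
Proof.
move=> sn; have [->|] := eqVneq [set` s] set0; first exact: card_ge0.
move=> /set0P[y0 y0s].
apply: (@card_le_trans _ _ _ `I_(size s)); last by rewrite card_le_II.
apply: card_le_trans (card_image_le (nth y0 s) `I_(size s)).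
apply: subset_card_le => y /= ys; exists (index y s); first by rewrite /= index_mem.
by rewrite nth_index.
Qed.

Lemma quantization_error_ge n (b : R) : 0 <= b ->
  (forall a : set 'rV[R]_q, a !=set0 -> (a #<= `I_n)%card ->
    (b%:E <= \int[P]_x (l2dist_set x a `^ r)%:E)%E) ->
  ((b `^ r^-1)%:E <= quantization_error r P n)%E.
Proof.
move=> b0 h; apply: le_ereal_inf_tmp => _ [a [a0 an] <-].
rewrite -poweR_EFin; apply: gt0_ler_poweR.
- by rewrite invr_ge0 ltW.
- by rewrite in_itv/= lee_fin b0 leey.
- rewrite in_itv/= leey andbT; apply: integral_ge0 => x _.
  by rewrite lee_fin powR_ge0.
- exact: h.
Qed.

Lemma quantization_error_le n (k d : R) : k <= n%:R -> covered P r k d ->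
  (quantization_error r P n <= (d `^ r^-1)%:E)%E.
Proof.
move=> kn [s [s0 sk sd]].
have I0 : (0 <= \int[P]_x (l2dist_set x [set` s] `^ r)%:E)%E.
  by apply: integral_ge0 => x _; rewrite lee_fin powR_ge0.
apply: (@le_trans _ _
  (poweR (\int[P]_x (l2dist_set x [set` s] `^ r)%:E)%E r^-1)).
  apply: ereal_inf_lbound; exists [set` s] => //; split.
    case: s s0 {sk sd I0} => // y s _; exists y.
    by rewrite /= mem_head.
  by apply: card_seq_le; rewrite -(ler_nat R) (le_trans sk).
rewrite -poweR_EFin; apply: gt0_ler_poweR => //.
- by rewrite invr_ge0 ltW.
- by rewrite in_itv/= leey I0.
- by rewrite in_itv/= leey andbT (le_trans I0).
Qed.

Lemma error_exponent (s x : R) : 0 < s -> 0 < x ->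
  (x `^ (1 - (1 + r / s))) `^ r^-1 = x `^ (- s^-1).
Proof.
move=> s0 x0; rewrite -powRrM; congr (_ `^ _).
by field; rewrite !gt_eqF.
Qed.

Lemma error_upper_bound (s om K D : R) : 0 < s -> 0 < K -> 0 <= D ->
  (forall x, om <= x -> covered P r (K * x) (D * x `^ (1 - (1 + r / s)))) ->
  exists2 A : R, 0 < A & exists m, forall n, (m <= n)%N ->
    (quantization_error r P n <= (A * n%:R `^ (- s^-1))%:E)%E.
Proof.
move=> s0 K0 D0 cov.
exists (D `^ r^-1 * K `^ s^-1 + 1).
  by rewrite ltr_wpDl// mulr_ge0 ?powR_ge0.
exists (Num.truncn (K * `|om|)).+1 => n mn.
have nK : K * `|om| < n%:R.
  apply: lt_le_trans (_ : (Num.truncn (K * `|om|)).+1%:R <= _); last by rewrite ler_nat.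
  by have /andP[] := truncn_itv (mulr_ge0 (ltW K0) (normr_ge0 om)).
have n0 : 0 < n%:R :> R by rewrite ltr0n (leq_trans _ mn).
have omx : om <= n%:R / K.
  by rewrite ler_pdivlMr// mulrC (le_trans _ (ltW nK))// ler_pM2l// ler_norm.
have x0 : 0 < n%:R / K by rewrite divr_gt0.
apply: le_trans (quantization_error_le _ (cov _ omx)) _.
  by rewrite mulrC divfK// gt_eqF.
rewrite lee_fin powRM ?powR_ge0// error_exponent// powRM ?invr_ge0 ?(ltW K0)//.
rewrite -[K^-1]powR_inv1 ?(ltW K0)// -powRrM mulN1r opprK mulrCA mulrC.
rewrite ler_wpM2r ?powR_ge0// lerDl//.
Qed.

Lemma error_lower_bound (s B : R) n : 0 < s -> (0 < n)%N -> 0 <= B ->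
  (forall a : set 'rV[R]_q, a !=set0 -> (a #<= `I_n)%card ->
    ((B * n%:R `^ (1 - (1 + r / s)))%:E <=
      \int[P]_x (l2dist_set x a `^ r)%:E)%E) ->
  ((B `^ r^-1 * n%:R `^ (- s^-1))%:E <= quantization_error r P n)%E.
Proof.
move=> s0 n0 B0 h; have n0' : 0 < n%:R :> R by rewrite ltr0n.
rewrite -error_exponent// -powRM ?powR_ge0//.
by apply: quantization_error_ge => //; rewrite mulr_ge0 ?powR_ge0.
Qed.

End quantization_error.

Section limits.
Variable R : realType.
Implicit Types u : nat -> \bar R.

Lemma limn_esup_le u (l : \bar R) m : (forall n, (m <= n)%N -> (u n <= l)%E) ->
  (limn_esup u <= l)%E.
Proof.
move=> ul; rewrite /limn_esup /limf_esup.
apply: ge_ereal_inf; exists (ereal_sup (u @` [set n | (m <= n)%N])).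
  by exists [set n | (m <= n)%N] => //; exists m.
by apply: ge_ereal_sup => _ [n mn <-]; exact: ul.
Qed.

Lemma limn_einf_ge u (l : \bar R) m : (forall n, (m <= n)%N -> (l <= u n)%E) ->
  (l <= limn_einf u)%E.
Proof.
move=> lu; rewrite /limn_einf leeNr; apply: (@limn_esup_le _ _ m) => n mn.
by rewrite leeN2 lu.
Qed.

Lemma ln_nat_ge (B : R) : exists m, forall n, (m <= n)%N -> B <= ln n%:R.
Proof.
exists (Num.truncn (expR B)).+1 => n mn.
have Bn : expR B <= n%:R.
  apply: le_trans (_ : (Num.truncn (expR B)).+1%:R <= _); last by rewrite ler_nat.
  by have /andP[_ /ltW] := truncn_itv (expR_ge0 B).
by rewrite -[leLHS]expRK ler_ln// posrE ?expR_gt0// (lt_le_trans _ Bn) ?expR_gt0.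
Qed.

End limits.

(** * Asymptotics of the quantization error *)

Section asymptotics.
Variables (R : realType) (q : nat) (r : R) (P : probability (borel_rV R q) R).
Local Notation err := (quantization_error r P).

(** The small gaps between the exponents absorb the constants [A] and [c] once
    [ln n] is large. *)
Lemma quantization_ratio_bounds (s1 s s' s'' A c : R) m :
  0 < s1 -> s1 < s -> 0 < s' -> s' < s'' -> 0 < A -> 0 < c ->
  (forall n, (m <= n)%N -> (err n <= (A * n%:R `^ (- s1^-1))%:E)%E) ->
  (forall n, (m <= n)%N -> ((c * n%:R `^ (- s''^-1))%:E <= err n)%E) ->
  exists m', forall n, (m' <= n)%N ->
    (s'%:E <= quantization_ratio r P n)%E /\ (quantization_ratio r P n <= s%:E)%E.
Proof.
move=> s10 s1s s'0 s's'' A0 c0 upp low.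
have s0 : 0 < s by exact: lt_trans s1s.
have s''0 : 0 < s'' by exact: lt_trans s's''.
have gap1 : 0 < s1^-1 - s^-1 by rewrite subr_gt0 ltf_pV2.
have gap2 : 0 < s'^-1 - s''^-1 by rewrite subr_gt0 ltf_pV2.
have [m1 lnm1] := ln_nat_ge (1 + `|ln A| / (s1^-1 - s^-1) + `|ln c| / (s'^-1 - s''^-1)).
exists (maxn 1 (maxn m m1)) => n; rewrite !geq_max => /and3P[n1 mn m1n].
have n0 : 0 < n%:R :> R by rewrite ltr0n.
have := lnm1 n m1n; have := upp n mn; have := low n mn.
rewrite /quantization_ratio; case: (err n) => [e| |]; last 2 first.
- by rewrite leye_eq.
- by rewrite leeNy_eq.
rewrite /= !lee_fin => ce eA lnn.
have e0 : 0 < e by apply: lt_le_trans ce; rewrite mulr_gt0 ?powR_gt0.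
have lne1 : ln e <= ln A - ln n%:R / s1.
  apply: le_trans (_ : ln (A * n%:R `^ (- s1^-1)) <= _).
    by rewrite ler_ln// posrE mulr_gt0 ?powR_gt0.
  by rewrite lnM ?posrE ?powR_gt0// ln_powR mulNr mulrC.
have lne2 : ln c - ln n%:R / s'' <= ln e.
  apply: le_trans (_ : ln (c * n%:R `^ (- s''^-1)) <= _).
    by rewrite lnM ?posrE ?powR_gt0// ln_powR mulNr mulrC.
  by rewrite ler_ln// posrE mulr_gt0 ?powR_gt0.
have a1 : 0 <= `|ln A| / (s1^-1 - s^-1) by rewrite divr_ge0 ?(ltW gap1).
have a2 : 0 <= `|ln c| / (s'^-1 - s''^-1) by rewrite divr_ge0 ?(ltW gap2).
have ln0 : 0 < ln n%:R :> R by lra.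
have hA : `|ln A| <= ln n%:R * (s1^-1 - s^-1).
  by rewrite -ler_pdivrMr//; lra.
have hc : `|ln c| <= ln n%:R * (s'^-1 - s''^-1).
  by rewrite -ler_pdivrMr//; lra.
have := ler_norm (ln A); have := ler_norm (- ln c); rewrite normrN.
rewrite mulrBr in hA; rewrite mulrBr in hc => k1 k2.
have b1 : ln n%:R / s <= - ln e by lra.
have b2 : - ln e <= ln n%:R / s' by lra.
have e1 : 0 < - ln e by apply: lt_le_trans b1; rewrite divr_gt0.
split.
  by rewrite ler_pdivlMr// mulrC -ler_pdivlMr.
by rewrite ler_pdivrMr// mulrC -ler_pdivrMr.
Qed.

Lemma has_quantization_dim_of_bounds (xi c : R) m :
  0 < xi -> 0 < c ->
  (forall n, (m <= n)%N -> ((c * n%:R `^ (- xi^-1))%:E <= err n)%E) ->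
  (forall s, xi < s -> exists2 A, 0 < A & exists m', forall n, (m' <= n)%N ->
    (err n <= (A * n%:R `^ (- s^-1))%:E)%E) ->
  has_quantization_dim r P xi%:E.
Proof.
move=> xi0 c0 low upp.
have bounds d : 0 < d < xi -> exists m', forall n, (m' <= n)%N ->
    ((xi - d)%:E <= quantization_ratio r P n)%E /\
    (quantization_ratio r P n <= (xi + d)%:E)%E.
  move=> /andP[d0 dxi]; have xid : xi < xi + d / 2 by rewrite ltrDl divr_gt0.
  have [A A0 [m' uppd]] := upp _ xid.
  apply: (@quantization_ratio_bounds (xi + d / 2) (xi + d) (xi - d) xi A c
    (maxn m m')) => //; try lra.
  - by move=> n; rewrite geq_max => /andP[_ /uppd].
  - by move=> n; rewrite geq_max => /andP[/low].
have small d : 0 < d -> 0 < Num.min d (xi / 2) < xi.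
  by move=> d0; rewrite lt_min gt_min d0 divr_gt0//= ltr_pdivrMr// ltr_pMr ?ltr1n ?orbT.
have up : (upper_quantization_dim r P <= xi%:E)%E.
  apply/lee_addgt0Pr => d d0; have [m' bd] := bounds _ (small d d0).
  apply: (@limn_esup_le _ _ _ m') => n /bd[_ /le_trans]; apply.
  by rewrite -EFinD lee_fin lerD2l ge_min lexx.
have lo : (xi%:E <= lower_quantization_dim r P)%E.
  apply/lee_subgt0Pr => d d0; have [m' bd] := bounds _ (small d d0).
  apply: (@limn_einf_ge _ _ _ m') => n /bd[+ _]; apply: le_trans.
  by rewrite -EFinB lee_fin lerD2l lerN2 ge_min lexx.
have lu : (lower_quantization_dim r P <= upper_quantization_dim r P)%E.
  exact: limn_einf_sup.
split; apply/eqP; rewrite eq_le.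
  by rewrite up (le_trans lo).
by rewrite lo (le_trans lu).
Qed.

Lemma lower_coef_ge (s B : R) m : (0 < m)%N ->
  (forall n, (m <= n)%N -> ((B * n%:R `^ (- s^-1))%:E <= err n)%E) ->
  (B%:E <= lower_quantization_coef r s P)%E.
Proof.
move=> m0 h; apply: (@limn_einf_ge _ _ _ m) => n mn.
have n0 : 0 < n%:R :> R by rewrite ltr0n (leq_trans m0).
apply: le_trans (lee_wpmul2l _ (h n mn)); last by rewrite lee_fin powR_ge0.
by rewrite -EFinM lee_fin mulrCA powRN divff ?mulr1// gt_eqF// powR_gt0.
Qed.

Lemma upper_coef_le (s A : R) m :
  (forall n, (m <= n)%N -> (err n <= (A * n%:R `^ (- s^-1))%:E)%E) ->
  (upper_quantization_coef r s P <= A%:E)%E.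
Proof.
move=> h; apply: (@limn_esup_le _ _ _ (maxn 1 m)) => n.
rewrite geq_max => /andP[n1 mn].
have n0 : 0 < n%:R :> R by rewrite ltr0n.
apply: le_trans (lee_wpmul2l _ (h n mn)) _; first by rewrite lee_fin powR_ge0.
by rewrite -EFinM lee_fin mulrCA powRN divff ?mulr1// gt_eqF// powR_gt0.
Qed.

End asymptotics.

Section error_lower_bounds.
Variables (R : realType) (q : nat).
Local Notation T := (borel_rV R q).
Implicit Types (P nu mu : probability T R).

(** A packing by about [C + 1] times as many cells as points leaves at least
    one uncrowded cell per point. *)
Lemma self_similar_error n (t c v : 'I_n -> R) g O P r e rad eta del :
  0 < r -> dominates t g (fun=> P) P -> (forall i, 0 < t i) ->
  (forall i, similitude (g i) (c i) /\ c i <= 1) ->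
  open O -> O !=set0 -> (forall i, g i @` O `<=` O) ->
  (forall i j, i != j -> g i @` O `&` g j @` O = set0) ->
  spread P rad eta del ->
  0 < e -> (forall i, 0 < v i < 1) -> \sum_i v i = 1 ->
  (forall i, t i * c i `^ r = v i `^ e) ->
  exists2 B : R, 0 < B & forall k (a : set 'rV[R]_q), (0 < k)%N ->
    a !=set0 -> (a #<= `I_k)%card ->
    ((B * k%:R `^ (1 - e))%:E <= \int[P]_x (l2dist_set x a `^ r)%:E)%E.
Proof.
move=> r0 domP t0 sim oO O0 gO dis spP e0 v01 v1 tcv.
have [om om0 grow] := packed_growth domP t0 sim gO dis e0 v01 v1 tcv.
have [C [ka [ka0 lowP]]] := packed_error oO O0 r0 spP.
pose Z := C.+1%:R + om; have Z0 : 0 < Z by rewrite addr_gt0.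
exists (ka * (om / Z) `^ e); first by rewrite mulr_gt0 ?powR_gt0 ?divr_gt0.
move=> k a k0 a0 ak; have k0' : 0 < k%:R :> R by rewrite ltr0n.
have k1 : 1 <= k%:R :> R by rewrite ler1n.
have [S [packS cardS massS]] : exists S : cells R q,
    [/\ packed O O P P S, Z * k%:R <= #|cell_idx S|%:R &
      forall j : cell_idx S, (om / (Z * k%:R)) `^ e <=
        cell_mass j * cell_ratio j `^ r].
  apply: grow; apply: le_trans (_ : Z <= _); first by rewrite lerDr.
  by rewrite ler_peMr// ltW.
apply: le_trans (lowP _ _ _ _ _ _ packS (powR_ge0 _ _) massS a0 ak).
rewrite lee_fin.
have -> : om / (Z * k%:R) = om / Z * k%:R^-1 by field; rewrite !gt_eqF.
rewrite (@powRM _ (om / Z)) ?divr_ge0 ?invr_ge0 ?(ltW om0) ?(ltW Z0)//.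
rewrite -[k%:R^-1]powR_inv1 ?(ltW k0')// -powRrM mulN1r.
have -> : k%:R `^ (1 - e) = k%:R * k%:R `^ (- e).
  by rewrite powRD ?powRr1 ?(ltW k0')// (gt_eqF k0') implybT.
have -> : ka * (om / Z) `^ e * (k%:R * k%:R `^ (- e)) =
    k%:R * (ka * ((om / Z) `^ e * k%:R `^ (- e))) by ring.
rewrite -mulrA ler_wpM2r ?mulr_ge0 ?powR_ge0 ?(ltW ka0)//.
rewrite lerBrDr; apply: le_trans cardS.
by rewrite natrM /Z -natr1; have := mulr_gt0 om0 k0'; lra.
Qed.

Lemma integral_inhomogeneous N (f : 'I_N -> 'rV[R]_q -> 'rV[R]_q) p s nu mu
    (phi : 'rV[R]_q -> R) :
  inhomogeneous_self_similar_measure f p nu mu -> (forall i, 0 <= p i) ->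
  (forall i, similitude (f i) (s i)) ->
  measurable_fun [set: T] (phi : T -> R) -> (forall x, 0 <= phi x) ->
  (\int[mu]_x (phi x)%:E = (p ord0)%:E * \int[nu]_x (phi x)%:E +
    \sum_(i < N) (p (lift ord0 i))%:E * \int[mu]_x (phi (f i x))%:E)%E.
Proof.
move=> /mixture_with_head mixmu p0 sim mphi phi0.
have ch i : continuous (with_head id f i).
  move: i; apply: forall_head => [|j]; rewrite ?with_head0 ?with_headS.
    by move=> x; exact: cvg_id.
  exact: similitude_continuous (sim j).
rewrite (integral_mixture p0 ch mixmu mphi phi0) big_ord_recl !with_head0.
by congr (_ + _)%E; apply: eq_bigr => j _; rewrite !with_headS.
Qed.

(** With [k] levels of cells the error is larger than the self-similar one by
    a factor of order [k `^ e]. *)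
Lemma interleaved_error N (f : 'I_N -> 'rV[R]_q -> 'rV[R]_q) p s v nu mu O U
    r e om rad eta del :
  0 < r -> inhomogeneous_self_similar_measure f p nu mu -> (forall i, 0 < p i) ->
  (forall i, similitude (f i) (s i) /\ s i <= 1) ->
  (forall i, f i @` U `<=` U) -> O `<=` U ->
  (forall i j, i != j -> f i @` U `&` f j @` U = set0) ->
  (forall i, O `&` f i @` U = set0) -> open O -> O !=set0 ->
  spread nu rad eta del ->
  1 <= e -> (forall i, 0 < v i < 1) -> \sum_i v i = 1 ->
  (forall i, p (lift ord0 i) * s i `^ r = v i `^ e) ->
  0 < om -> (forall x, om <= x -> exists S : cells R q,
    [/\ packed O O nu nu S, x <= #|cell_idx S|%:R &
      forall j : cell_idx S, (om / x) `^ e <= cell_mass j * cell_ratio j `^ r]) ->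
  forall B : R, exists m, forall n (a : set 'rV[R]_q), (m < n)%N ->
    a !=set0 -> (a #<= `I_n)%card ->
    ((B * n%:R `^ (1 - e))%:E <= \int[mu]_x (l2dist_set x a `^ r)%:E)%E.
Proof.
move=> r0 hmu p0 sim fU OU disf disO oO O0 spnu e1 v01 v1 psv om0 grow B.
have e0 : 0 < e by exact: lt_le_trans e1.
have [C [ka [ka0 lown]]] := packed_error oO O0 r0 spnu.
pose Z : R := C.+1%:R; have Z0 : 0 < Z by rewrite ltr0n.
pose F := ka * p ord0 * (om / Z) `^ e.
have F0 : 0 < F by rewrite mulr_gt0 ?powR_gt0 ?divr_gt0// mulr_gt0.
pose k := (Num.truncn (`|B| / F)).+1.
have Bk : B <= F * k%:R.
  rewrite mulrC -ler_pdivrMr//; apply: (@le_trans _ _ (`|B| / F)).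
    by rewrite ler_wpM2r ?invr_ge0 ?(ltW F0)// ler_norm.
  by have /andP[_ /ltW] := truncn_itv (divr_ge0 (normr_ge0 B) (ltW F0)).
have k0 : 0 < k%:R :> R by rewrite ltr0n.
have [X X0 growX] :=
  interleaved_growth hmu p0 sim fU OU disf disO e0 v01 v1 psv om0 grow k.
exists (Num.truncn (X * k%:R / Z)).+1 => n a mn a0 an.
have n0 : 0 < n%:R :> R by rewrite ltr0n (leq_ltn_trans _ mn).
have Xn : X <= Z * n%:R / k%:R.
  rewrite ler_pdivlMr// -ler_pdivrMl// mulrC.
  apply: le_trans (_ : (Num.truncn (X * k%:R / Z)).+1%:R <= _).
    have /andP[_ /ltW] // : (Num.truncn (X * k%:R / Z))%:R <= X * k%:R / Z <
        (Num.truncn (X * k%:R / Z)).+1%:R.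
    by apply: truncn_itv; rewrite divr_ge0 ?mulr_ge0 ?(ltW X0) ?(ltW Z0) ?(ltW k0).
  by rewrite ler_nat ltnW.
have [S [packS cardS massS]] := growX _ Xn.
have b0 : 0 <= p ord0 * (om / (Z * n%:R / k%:R)) `^ e.
  by rewrite mulr_ge0 ?powR_ge0 ?(ltW (p0 ord0)).
apply: le_trans (lown _ _ _ _ _ _ packS b0 massS a0 an); rewrite lee_fin.
have -> : om / (Z * n%:R / k%:R) = om / Z * (k%:R * n%:R^-1).
  by field; rewrite !gt_eqF.
rewrite (@powRM _ (om / Z)) ?divr_ge0 ?mulr_ge0 ?invr_ge0 ?(ltW om0)
  ?(ltW Z0) ?(ltW k0) ?(ltW n0)//.
rewrite (@powRM _ k%:R) ?invr_ge0 ?(ltW k0) ?(ltW n0)//.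
rewrite -[n%:R^-1]powR_inv1 ?(ltW n0)// -powRrM mulN1r.
have -> : n%:R `^ (1 - e) = n%:R * n%:R `^ (- e).
  by rewrite powRD ?powRr1 ?(ltW n0)// (gt_eqF n0) implybT.
have nCS : n%:R <= #|cell_idx S|%:R - (n * C)%:R :> R.
  rewrite lerBrDr; apply: le_trans cardS.
  rewrite mulrCA divff ?gt_eqF// mulr1 natrM /Z -natr1; lra.
have kk : k%:R <= k%:R `^ e by apply: le1r_powR; rewrite ?ler1n.
apply: (@le_trans _ _ (n%:R * (F * k%:R `^ e * n%:R `^ (- e)))).
  rewrite mulrCA ler_wpM2l ?(ltW n0)// ler_wpM2r ?powR_ge0//.
  by apply: le_trans Bk _; rewrite ler_pM2l.
have -> : F * k%:R `^ e * n%:R `^ (- e) =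
    ka * (p ord0 * ((om / Z) `^ e * (k%:R `^ e * n%:R `^ (- e)))) by rewrite /F; ring.
rewrite -mulrA ler_wpM2r// !mulr_ge0 ?powR_ge0 ?(ltW ka0) ?(ltW (p0 ord0))//.
Qed.

End error_lower_bounds.

(** * Quantization dimension and coefficients *)

Theorem theorem1p2 (R : realType) (q M N : nat)
    (hM : (2 <= M)%N) (hN : (2 <= N)%N)
    (r : R) (hr : 0 < r)
    (g : 'I_M -> 'rV[R]_q -> 'rV[R]_q) (c : 'I_M -> R)
    (hg : forall i, contractive_similitude (g i) (c i))
    (hOSC : open_set_condition g)
    (t : 'I_M -> R) (ht : probability_vector t) (ht0 : forall i, 0 < t i)
    (nu : probability (borel_rV R q) R)
    (hnu : self_similar_measure g t nu)
    (f : 'I_N -> 'rV[R]_q -> 'rV[R]_q) (s : 'I_N -> R)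
    (hf : forall i, contractive_similitude (f i) (s i))
    (p : 'I_N.+1 -> R) (hp : probability_vector p) (hp0 : forall i, 0 < p i)
    (E : set 'rV[R]_q) (hE : self_similar_set f E)
    (hIOSC : inhomogeneous_OSC f E nu)
    (mu : probability (borel_rV R q) R)
    (hmu : inhomogeneous_self_similar_measure f p nu mu)
    (s_r t_r : R) (hs_r : 0 < s_r) (ht_r : 0 < t_r)
    (hs_r_eq : \sum_(i < M) (t i * c i `^ r) `^ (s_r / (s_r + r)) = 1)
    (ht_r_eq :
       \sum_(i < N) (p (lift ord0 i) * s i `^ r) `^ (t_r / (t_r + r)) = 1) :
  let xi_r := Num.max s_r t_r in
  [/\ has_quantization_dim r mu xi_r%:E,
      (0 < lower_quantization_coef r xi_r mu)%E,
      (t_r < s_r -> (upper_quantization_coef r xi_r mu < +oo)%E) &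
      (s_r = t_r -> lower_quantization_coef r xi_r mu = +oo%E)].
Proof.
move=> xi.
case: hOSC => O [oO _ O0 gO disO].
have [U [[oU _ U0] [fU disU [_ CU] [_ CfU]]]] := hIOSC.
have simg i := contractive_similitudeW (hg i).
have simf i := contractive_similitudeW (hf i).
have p0 i : 0 <= p i by exact: ltW.
have t0 i : 0 <= t i by exact: ltW.
have bnu := self_similar_bounded hg ht hnu.
have bmu := inhomogeneous_bounded hf hp bnu hmu.
have [rad [eta [del spnu]]] := self_similar_spread hM hg ht ht0 hnu oO O0 gO disO.
have spmu : spread mu rad eta (p ord0 * del).
  apply: (@mixture_spread _ _ _ _ _ _ _ ord0 _ _ _ (mixture_with_head hmu)) => //.
    by rewrite with_head0.
  by rewrite with_head0.
have domnu : dominates t g (fun=> nu) nu.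
  by apply: mixture_dominates => // i; apply: similitude_continuous (simg i).1.
have intmu phi := @integral_inhomogeneous _ _ _ _ _ _ _ _ phi hmu p0
  (fun i => (simf i).1).
have dommu : dominates (p \o lift ord0) f (fun=> mu) mu.
  move=> phi mphi phi0; rewrite [leRHS]intmu// leeDr//.
  by rewrite mule_ge0 ?lee_fin// integral_ge0// => x _; rewrite lee_fin.
have ab01 n (w b : 'I_n -> R) (h : 'I_n -> 'rV[R]_q -> 'rV[R]_q) i :
    (forall j, 0 < w j) -> \sum_j w j <= 1 ->
    (forall j, contractive_similitude (h j) (b j)) -> 0 < w i * b i `^ r < 1.
  move=> w0 w1 simh; have [/andP[b0 b1] _] := simh i.
  rewrite mulr_gt0 ?powR_gt0//=.
  have wi : w i <= 1.
    by apply: le_trans w1; rewrite (bigD1 i)//= lerDl sumr_ge0// => j _; exact: ltW.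
  apply: le_lt_trans (_ : b i `^ r < 1); first by rewrite ler_piMl// powR_ge0.
  apply: lt_le_trans (_ : 1 `^ r <= _); last by rewrite powR1.
  by apply: gt0_ltr_powR; rewrite ?nnegrE ?ltW.
have a01 i : 0 < t i * c i `^ r < 1.
  by apply: (ab01 M t c g) => //; rewrite ht.2.
have b01 i : 0 < p (lift ord0 i) * s i `^ r < 1.
  apply: (ab01 N (p \o lift ord0) s f) => //; first by move=> j; exact: hp0.
  by rewrite -hp.2 [leRHS]big_ord_recl lerDr.
pose V x i := proportion r x (t i * c i `^ r).
pose W x i := proportion r x (p (lift ord0 i) * s i `^ r).
have V01 x i : 0 < x -> 0 < V x i < 1 by move=> x0; exact: proportion_itv.
have W01 x i : 0 < x -> 0 < W x i < 1 by move=> x0; exact: proportion_itv.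
have tcV x i : 0 < x -> t i * c i `^ r = V x i `^ (1 + r / x).
  by move=> x0; apply: proportion_powR => //; have /andP[/ltW] := a01 i.
have psW x i : 0 < x -> p (lift ord0 i) * s i `^ r = W x i `^ (1 + r / x).
  by move=> x0; apply: proportion_powR => //; have /andP[/ltW] := b01 i.
have V1 x : s_r <= x -> \sum_i V x i <= 1.
  by move=> sx; rewrite -hs_r_eq; apply: ler_sum => i _; exact: ler_proportion.
have W1 x : t_r < x -> \sum_i W x i < 1.
  move=> tx; rewrite -ht_r_eq; apply: ltr_sum => [|i _].
    by apply/hasP; exists (Ordinal (ltnW hN)); rewrite ?mem_index_enum.
  exact: ltr_proportion.
have expo x : 0 < x -> 1 <= 1 + r / x by move=> x0; rewrite lerDl divr_ge0 ?ltW.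
have xi0 : 0 < xi by rewrite lt_max hs_r.
have upper x : s_r <= x -> t_r < x -> exists2 A : R, 0 < A & exists m,
    forall n, (m <= n)%N ->
    (quantization_error r mu n <= (A * n%:R `^ (- x^-1))%:E)%E.
  move=> sx tx; have x0 : 0 < x by exact: lt_trans tx.
  have [om0 [K0 [D0 [/andP[om00 om01] K00 D00 cov0]]]] :=
    self_similar_covered (ltnW hM) hr hnu t0 (fun i => (simg i).1) bnu (expo x x0)
      (fun i => V01 x i x0) (V1 x sx) (fun i => tcV x i x0).
  have [om [K [D [_ K_gt0 D_ge0 cov]]]] :=
    inhomogeneous_covered hr hmu hp (fun i => (simf i).1) bmu (expo x x0)
      (fun i => W01 x i x0) (W1 x tx) (fun i => psW x i x0) om01 (ltW K00) D00 cov0.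
  exact: error_upper_bound cov.
have lower : exists2 B : R, 0 < B & forall n (a : set 'rV[R]_q), (0 < n)%N ->
    a !=set0 -> (a #<= `I_n)%card ->
    ((B * n%:R `^ (1 - (1 + r / xi)))%:E <=
      \int[mu]_x (l2dist_set x a `^ r)%:E)%E.
  have e0 x : 0 < x -> 0 < 1 + r / x by move=> /expo; exact: lt_le_trans.
  rewrite /xi; case: leP => _.
    exact: (@self_similar_error _ _ _ (p \o lift ord0) s (W t_r) f U mu r
      (1 + r / t_r) _ _ _ hr dommu (fun i => hp0 (lift ord0 i)) simf oU U0 fU disU spmu (e0 _ ht_r)
      (fun i => W01 _ i ht_r) ht_r_eq (fun i => psW _ i ht_r)).
  have [B B0 lownu] := self_similar_error hr domnu ht0 simg oO O0 gO disO spnu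
     (e0 _ hs_r) (fun i => V01 _ i hs_r) hs_r_eq (fun i => tcV _ i hs_r).
  exists (p ord0 * B); first exact: mulr_gt0.
  move=> n a n0 a0 an; rewrite [leRHS]intmu; last 2 first.
  - exact: measurable_l2dist_set.
  - by move=> y; exact: powR_ge0.
  apply: le_trans (leeDl _ _); last first.
    apply: sume_ge0 => i _; rewrite mule_ge0 ?lee_fin// integral_ge0// => y _.
    by rewrite lee_fin powR_ge0.
  rewrite -mulrA EFinM; apply: lee_wpmul2l; first by rewrite lee_fin.
  exact: lownu.
have [B B0 lowB] := lower.
have lowerr n : (0 < n)%N ->
    ((B `^ r^-1 * n%:R `^ (- xi^-1))%:E <= quantization_error r mu n)%E.
  by move=> n0; apply: error_lower_bound => // [|a]; [exact: ltW|exact: lowB].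
have B'0 : 0 < B `^ r^-1 by rewrite powR_gt0.
split.
- apply: (has_quantization_dim_of_bounds xi0 B'0 lowerr) => x xix.
  by apply: upper; [apply/ltW|]; apply: le_lt_trans xix; rewrite le_max lexx ?orbT.
- by apply: lt_le_trans (lower_coef_ge (ltn0Sn 0) lowerr); rewrite lte_fin.
- move=> ts; have xiE : xi = s_r by rewrite /xi; case: leP ts => //; lra.
  have [A A0 [m uppA]] := upper s_r (lexx _) ts.
  rewrite xiE; apply: le_lt_trans (upper_coef_le uppA) _.
  exact: ltry.
move=> st; have xiE : xi = s_r by rewrite /xi -st maxxx.
have [C0 cC] : msupport nu !=set0 /\ compact (msupport nu).
  by split; [exact: msupport_neq0|exact: compact_msupport].
have gC i x : msupport nu x -> msupport nu (g i x).
  apply: (@mixture_msupport _ _ _ t g (fun=> nu)) => //.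
  exact: similitude_continuous (simg i).1.
(* [O] may leave [U] or meet the [f i @` U]; near the support it does neither *)
have [d0 d00 hd0] : exists2 d : R, 0 < d &
    forall x y, msupport nu x -> (~` U) y -> d <= l2dist x y.
  apply: compact_closed_gap => //; first exact: open_closedC.
  by apply/seteqP; split=> // x [/CU].
have /choice[d dP] : forall i, exists d : R, 0 < d /\
    forall x y, msupport nu x -> (f i @` closure U) y -> d <= l2dist x y.
  move=> i; have [d d_gt0 hd] := compact_closed_gap cC
    (closed_similitude_image (simf i).1 (@closed_closure _ U)) (CfU i).
  by exists d.
have [d1 /andP[d10 _] d1d] := finite_lower_bound (fun i => (dP i).1).
pose de := Num.min d0 d1.
have de0 : 0 < de by rewrite lt_min d00.
pose O' := O `&` halo (msupport nu) de.
have [oO' O'0 gO'] := seed_halo (ltnW hM) hg oO O0 gO C0 gC de0.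
have O'U : O' `<=` U.
  move=> y [_ [x Cx xy]]; apply: contrapT => Uy.
  by have := hd0 x y Cx Uy; move: xy; rewrite lt_min => /andP[]; lra.
have O'fU i : O' `&` f i @` U = set0.
  apply/seteqP; split=> // y [[_ [x Cx xy]] [u Uu uy]].
  have := (dP i).2 x y Cx; have := d1d i; move: xy; rewrite lt_min => /andP[_ h1] h2.
  move=> h3; have : d i <= l2dist x y.
    by apply: h3; exists u => //; exact: subset_closure.
  by rewrite leNgt (lt_le_trans h1).
have disO' i j : i != j -> g i @` O' `&` g j @` O' = set0.
  by move=> ij; apply: subset_disjoint (disO i j ij); apply: image_subset => y [].
have ht_r_eq' : \sum_i W s_r i = 1 by rewrite st.
have e0 : 0 < 1 + r / s_r by apply: lt_le_trans (expo _ hs_r).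
have [om om0 grow] := packed_growth domnu ht0 simg gO' disO' e0
  (fun i => V01 _ i hs_r) hs_r_eq (fun i => tcV _ i hs_r).
have blow := interleaved_error hr hmu hp0 simf fU O'U disU O'fU oO' O'0 spnu
  (expo _ hs_r) (fun i => W01 _ i hs_r) ht_r_eq' (fun i => psW _ i hs_r) om0 grow.
apply/eqyP => L L0; rewrite xiE.
have [m lowL] := blow (L `^ r).
have -> : L = (L `^ r) `^ r^-1.
  by rewrite -powRrM divff ?powRr1 ?(ltW L0)// gt_eqF.
apply: (@lower_coef_ge _ _ _ _ _ _ m.+1) => // n mn.
apply: error_lower_bound => //; first exact: leq_ltn_trans mn.
  exact: powR_ge0.
by move=> a; exact: lowL.
Qed.
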